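(* Let $H$ be a nonzero complex Hilbert space, $A\in\mathcal B(H)$, and let $p$ be a monic polynomial with distinct roots $\Lambda=\{\lambda_1,\dots,\lambda_d\}$, $d\ge1$, such that $N=p(A)$ is normal. Then the mapping $$\chi_A:\ C_\Lambda(p(\sigma(A)))\to\mathcal B(H),\qquad\chi_A(f)=\sum_{j=1}^d\delta_j(A)f_j(N),$$ is a continuous homomorphism. In particular, for all $f,g\in C_\Lambda(p(\sigma(A)))$, $$\chi_A(f\circledcirc g)=\chi_A(f)\,\chi_A(g)$$ and $$\|\chi_A(f)\|\le C\,\|f\|\quad\text{with}\quad C=\sum_{j=1}^d\|\delta_j(A)\|.$$
   Context: $\mathcal B(H)$ is the algebra of bounded linear operators on $H$ with the operator norm. Here $p(z)=(z-\lambda_1)\cdots(z-\lambda_d)$ and $\delta_j(z)=\prod_{k\neq j}\frac{z-\lambda_k}{\lambda_j-\lambda_k}$. For compact nonempty $M\subset\mathbb C$, $C_\Lambda(M)$ is the commutative unital Banach algebra of continuous functions $f:M\to\mathbb C^d$ with unit $\mathbf 1=(1,\dots,1)^t$ and product (polyproduct) given componentwise by $$(f\circledcirc g)_i(w)=f_i(w)g_i(w)-w\sum_{j\neq i}\frac{(f_i(w)-f_j(w))(g_i(w)-g_j(w))}{p'(\lambda_j)(\lambda_i-\lambda_j)},$$ and norm $\|f\|=\sup_{|g|_M\le1}|f\circledcirc g|_M$, where $|f|_M=\max_{w\in M}\max_j|f_j(w)|$. For the normal operator $N$ and $f_j$ continuous on $\sigma(N)=p(\sigma(A))$, $f_j(N)$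 is given by the continuous functional calculus: $f_j(N)=\lim_n q_{j,n}(N,N^* )$ for polynomials $q_{j,n}(w,\overline w)$ converging uniformly to $f_j$ on $\sigma(N)$. *)

(* Defs.v *)
From HB Require Import structures.
From mathcomp Require Import all_boot all_order all_algebra.
From mathcomp Require Import complex sesquilinear.
From mathcomp Require Import all_classical all_reals all_analysis.

Set Implicit Arguments.
Unset Strict Implicit.
Unset Printing Implicit Defensive.

Import Order.TTheory GRing.Theory Num.Theory.
Import numFieldNormedType.Exports.

Local Open Scope classical_set_scope.
Local Open Scope ring_scope.

(* MathComp-Analysis transfers the topology of [K^o] to [K] only for abstract
   numeric fields [K]; this does the same for the concrete field [R[i]]. *)
HB.instance Definition _ (R : rcfType) := PseudoPointedMetric.copy R[i] R[i]^o.
HB.instance Definition _ (R : rcfType) := GRing.ComAlgebra.copy R[i] R[i]^o.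
HB.instance Definition _ (R : rcfType) := Vector.copy R[i] R[i]^o.
HB.instance Definition _ (R : rcfType) := NormedModule.copy R[i] R[i]^o.

(* The norm of a normed module over [R[i]] takes its (real) values in [R[i]];
   [rnorm] is the same norm with values in [R], where suprema exist. *)
Definition rnorm (R : realType) (V : normedModType R[i]) (v : V) : R :=
  complex.Re `|v|.

Section BoundedOperators.
Variables (R : realType) (H : normedModType R[i]).
Local Notation C := R[i].
Implicit Types (T S : H -> H) (p : {poly C}).

Definition BH : set (H -> H) := [set T | linear T /\ continuous T].

Definition opnorm T : R :=
  sup [set rnorm (T x) | x in [set x : H | rnorm x <= 1]].

Definition spectrum T : set C :=
  [set z | ~ exists S, [/\ BH S,
       forall x, S (T x - z *: x) = x
     & forall x, T (S x) - z *: S x = x]].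

Definition opeval p T : H -> H :=
  fun x => \sum_(k < size p) p`_k *: iter k T x.

(* [q : {poly {poly C}}] stands for the polynomial in two variables
   q(w, v) = sum_(k, l) q`_l`_k w^k v^l: the outer variable is the second
   one, to be replaced by the conjugate of w or by the adjoint. *)
Definition bieval (q : {poly {poly C}}) (w v : C) : C := q.[v%:P].[w].

Definition opbieval (q : {poly {poly C}}) T S : H -> H :=
  fun x => \sum_(l < size q) \sum_(k < size q`_l)
             q`_l`_k *: iter k T (iter l S x).

End BoundedOperators.

Section Adjoint.
Variables (R : realType) (H : normedModType R[i]).
Variable ip : {dot H for @Num.conj R[i]}.
Implicit Types (T S : H -> H) (f : R[i] -> R[i]).

(* On a Hilbert space, a bounded operator has exactly one bounded adjoint, so
   the default value [0] is never used there. *)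
Definition adjoint T : H -> H :=
  xget 0 [set S | BH S /\ forall x y, ip (T x) y = ip x (S y)].

Definition normal_op T : Prop :=
  BH T /\ T \o adjoint T = adjoint T \o T.

Definition is_cfc T f (F : H -> H) : Prop :=
  BH F /\
  exists q : nat -> {poly {poly R[i]}},
    {uniform spectrum T, (fun n w => bieval (q n) w w^*) @ \oo --> f} /\
    opnorm (opbieval (q n) T (adjoint T) - F) @[n --> \oo] --> 0.

(* For [T] normal and [f] continuous on [spectrum T], there is exactly one
   [F] with [is_cfc T f F]. *)
Definition cfc T f : H -> H := xget 0 [set F | is_cfc T f F].

End Adjoint.

Section Polyproduct.
Variables (R : realType) (d : nat) (lam : 'I_d -> R[i]).
Local Notation C := R[i].
Implicit Types (M : set C) (f g : C -> 'cV[C]_d).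

Definition pLambda : {poly C} := \prod_(j < d) ('X - (lam j)%:P).

Definition delta (j : 'I_d) : {poly C} :=
  \prod_(k < d | k != j) ((lam j - lam k)^-1 *: ('X - (lam k)%:P)).

(* Elements of C_Lambda(M) are represented by functions on the whole plane;
   only their values on [M] matter below. *)
Definition CLambda M : set (C -> 'cV[C]_d) := [set f | {within M, continuous f}].

Definition polyone : C -> 'cV[C]_d := fun=> const_mx 1.

Definition polyprod f g : C -> 'cV[C]_d := fun w => \col_i
  (f w i 0 * g w i 0
   - w * \sum_(j < d | j != i)
       ((f w i 0 - f w j 0) * (g w i 0 - g w j 0)
        / ((pLambda^`()).[lam j] * (lam i - lam j)))).

Definition maxnorm M f : R :=
  sup [set rnorm (f w j 0) | w in M & j in [set: 'I_d]].

Definition CLnorm M f : R :=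
  sup [set maxnorm M (polyprod f g) | g in CLambda M `&` [set g | maxnorm M g <= 1]].

End Polyproduct.

Definition chi (R : realType) (H : normedModType R[i])
    (ip : {dot H for @Num.conj R[i]}) (d : nat) (lam : 'I_d -> R[i])
    (A : H -> H) (f : R[i] -> 'cV[R[i]]_d) : H -> H :=
  \sum_(j < d) (opeval (delta lam j) A
                \o cfc ip (opeval (pLambda lam) A) (fun w => f w j 0)).

(* Main.v *)
Require Import Defs.
From HB Require Import structures.
From mathcomp Require Import all_boot all_order all_algebra.
From mathcomp Require Import complex sesquilinear.
From mathcomp Require Import all_classical all_reals all_analysis.
From mathcomp Require Import ring lra zify.
From mathcomp Require cyclic separable cyclotomic.

Set Implicit Arguments.
Unset Strict Implicit.
Unset Printing Implicit Defensive.

Import Order.TTheory GRing.Theory Num.Theory.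
Import numFieldNormedType.Exports.

Local Open Scope classical_set_scope.
Local Open Scope ring_scope.

(** The map [chi] sends [f] to the sum of the operators [delta_j(A) f_j(N)]. That it is
    a homomorphism comes down to three facts: [f |-> f(N)] is a homomorphism from the
    continuous functions on the spectrum of [N] to the bounded operators; [A] commutes
    with all the operators [f(N)]; and the polynomials [delta_j] satisfy
    [delta_j delta_k = p (delta_j / p'(lam_k) - delta_k / p'(lam_j)) / (lam_j - lam_k)]
    for [j <> k], and add up to [1]. As [N = p(A)], the last identities turn the
    product of two sums [chi f] and [chi g] into the polyproduct ([chi_algebraM]). The
    norm estimate follows from [|f_j(N)| <= sup |f_j|], and from the fact that the norm
    of [f] dominates its max norm because the unit has max norm [1].

    The spectrum of [N] is compact, and equal to [p(sigma(A))] by the spectral mapping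
    theorem for polynomials. Bounded operators have adjoints by the Riesz
    representation theorem, proved by minimizing a quadratic functional.

    The heart of the functional calculus is the estimate of a polynomial in [N] and its
    adjoint by the supremum of the polynomial function on the spectrum
    ([starpoly_nrm_attained]). If [F] is such an operator, vectors on which [F] nearly
    attains its norm are approximate eigenvectors of [star F * F]. Among approximate
    eigenvectors of an operator there are approximate eigenvectors of any self-adjoint
    operator commuting with it ([apker_selfadj]); applying this to the real and
    imaginary parts of [N] gives approximate eigenvectors common to [star F * F] and
    [N], whose eigenvalue is a point of the spectrum of [N] at which the polynomial
    function has modulus [nrm F]. Together with Weierstrass approximation on compact
    subsets of the plane, obtained from Bernstein polynomials, this gives existence,
    uniqueness and multiplicativity of [f(N)] by density.

    That [A] commutes with [f(N)] requires Fuglede's theorem: an operator commuting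
    with a normal operator commutes with its adjoint. The classical proof applies
    Liouville's theorem to [exp(l S) A exp(- l S)], with [S] the adjoint of [N]. Here
    the exponentials are replaced by [(1 + u / m) ^ m], so that the norm estimate for
    polynomials applies, and Liouville's theorem by a Cauchy estimate averaged over
    roots of unity ([cauchy_estimate]). *)

(** * Norms with real values *)

Section RealNorm.
Variables (R : realType) (V : normedModType R[i]).
Implicit Types (v w : V) (z : R[i]).

Lemma rnormE v : `|v| = (rnorm v)%:C%C.
Proof. by rewrite /rnorm RRe_real // normr_real. Qed.

Lemma rnorm_ge0 v : 0 <= rnorm v.
Proof. by rewrite -lecR -rnormE normr_ge0. Qed.

Lemma rnorm0 : rnorm (0 : V) = 0.
Proof. by rewrite /rnorm normr0. Qed.

Lemma rnorm_eq0 v : rnorm v = 0 -> v = 0.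
Proof. by move=> v0; apply/eqP; rewrite -normr_eq0 rnormE v0. Qed.

Lemma rnorm_gt0 v : v != 0 -> 0 < rnorm v.
Proof. by move=> v0; rewrite lt0r rnorm_ge0 andbT; apply: contra_neq v0 => /rnorm_eq0. Qed.

Lemma ler_rnormD v w : rnorm (v + w) <= rnorm v + rnorm w.
Proof. by rewrite -lecR rmorphD /= -!rnormE ler_normD. Qed.

Lemma rnormN v : rnorm (- v) = rnorm v.
Proof. by rewrite /rnorm normrN. Qed.

Lemma rdistC v w : rnorm (v - w) = rnorm (w - v).
Proof. by rewrite /rnorm distrC. Qed.

Lemma ler_rnormB v w : rnorm (v - w) <= rnorm v + rnorm w.
Proof. by rewrite -(rnormN w) ler_rnormD. Qed.

Lemma ler_rdistD u v w : rnorm (v - w) <= rnorm (v - u) + rnorm (u - w).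
Proof. by rewrite -[v - w](subrKA u) ler_rnormD. Qed.

Lemma ler_rnorm_sub v w : rnorm v - rnorm w <= rnorm (v - w).
Proof. by rewrite lerBlDr -{1}(subrK w v) ler_rnormD. Qed.

Lemma rnormZ z v : rnorm (z *: v) = rnorm z * rnorm v.
Proof.
apply: (@complexI R); rewrite rmorphM /= -rnormE normrZ rnormE.
by congr (_ * _); rewrite -rnormE.
Qed.

Lemma ler_rnorm_sum (I : Type) (r : seq I) (P : pred I) (F : I -> V) :
  rnorm (\sum_(i <- r | P i) F i) <= \sum_(i <- r | P i) rnorm (F i).
Proof.
elim/big_ind2: _ => [|x a y b xa yb|//]; first by rewrite rnorm0.
exact: le_trans (ler_rnormD _ _) (lerD xa yb).
Qed.

(** Radii of balls in [V] are elements of [R[i]]; as positive complex numbers are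
    real, real radii suffice to describe the topology. *)
Lemma posC_Re (e : R[i]) : 0 < e -> e = (complex.Re e)%:C%C /\ 0 < complex.Re e.
Proof. by case: e => a b; rewrite ltcE /= => /andP[/eqP-> ->]. Qed.

Lemma nbhs_rnormP v (P : set V) :
  nbhs v P <-> exists2 e : R, 0 < e & forall w, rnorm (w - v) < e -> P w.
Proof.
split=> [/nbhs_normP[e /= e0 eP]|[e e0 eP]].
  have [eE e0'] := posC_Re e0; exists (complex.Re e) => // w wv; apply: eP => /=.
  by rewrite eE distrC rnormE ltcR.
apply/nbhs_normP; exists e%:C%C; first by rewrite /= ltcR.
by move=> w /=; rewrite distrC rnormE ltcR => /eP.
Qed.

Lemma cvgn_rnormP (u : nat -> V) (l : V) :
  u n @[n --> \oo] --> l <->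
  forall e : R, 0 < e -> \forall n \near \oo, rnorm (u n - l) < e.
Proof.
split=> [ul e e0|ul A /nbhs_rnormP[e e0 eA]].
  by apply: (ul [set w | rnorm (w - l) < e]); apply/nbhs_rnormP; exists e.
by apply: filterS (ul e e0) => n; exact: eA.
Qed.

End RealNorm.

Section RealNormScalar.
Variable R : realType.
Implicit Types z w : R[i].

Lemma rnormCE z : rnorm z = Num.sqrt (complex.Re z ^+ 2 + complex.Im z ^+ 2).
Proof. by rewrite /rnorm normc_def. Qed.

Lemma rnormM z w : rnorm (z * w) = rnorm z * rnorm w.
Proof. exact: (@rnormZ R R[i]^o z w). Qed.

Lemma rnorm1 : rnorm (1 : R[i]) = 1.
Proof. by apply: (@complexI R); rewrite -rnormE normr1. Qed.

Lemma rnormX z n : rnorm (z ^+ n) = rnorm z ^+ n.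
Proof. by elim: n => [|n IH]; rewrite ?expr0 ?rnorm1 // !exprS rnormM IH. Qed.

Lemma rnormV z : rnorm z^-1 = (rnorm z)^-1.
Proof. by apply: (@complexI R); rewrite fmorphV /= -!rnormE normfV. Qed.

Lemma rnorm_conj z : rnorm z^* = rnorm z.
Proof. by rewrite /rnorm norm_conjC. Qed.

Lemma rnorm_real (x : R) : rnorm x%:C%C = `|x|.
Proof. by rewrite rnormCE /= expr0n addr0 sqrtr_sqr. Qed.

Lemma rnorm_nat n : rnorm (n%:R : R[i]) = n%:R.
Proof. by apply: (@complexI R); rewrite -rnormE normr_nat rmorph_nat. Qed.

Lemma Re_realM (t : R) z : complex.Re (t%:C%C * z) = t * complex.Re z.
Proof. by case: z => a b /=; rewrite mul0r subr0. Qed.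

Lemma ler_rnorm_Re z : `|complex.Re z| <= rnorm z.
Proof. by rewrite -lecR -rnormE normc_ge_Re. Qed.

Lemma ler_rnorm_Im z : `|complex.Im z| <= rnorm z.
Proof. by rewrite rnormCE -sqrtr_sqr ler_wsqrtr // lerDr sqr_ge0. Qed.

End RealNormScalar.

(** * The algebra of bounded operators *)

Lemma nearooP (P : nat -> Prop) :
  (\forall n \near \oo, P n) <-> exists N, forall n, (N <= n)%N -> P n.
Proof. by split=> [[N _ NP]|[N NP]]; exists N. Qed.

Lemma invSn_lt (R : realType) (e : R) : 0 < e ->
  exists N, forall n, (N <= n)%N -> n.+1%:R^-1 < e.
Proof.
move=> e0; have /cvgrPdist_lt/(_ e e0)/nearooP[N NP] := @cvg_harmonic R.
by exists N => n /NP; rewrite sub0r normrN gtr0_norm // /harmonic invr_gt0.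
Qed.

Section BoundedMaps.
Variables (R : realType) (H : normedModType R[i]).
Implicit Types (T S : H -> H) (c : R).

Lemma linear_fun0 T : linear T -> T 0 = 0.
Proof. by move=> linT; have := linT (-1) 0 0; rewrite !scaleN1r !addNr. Qed.

Lemma linear_funZ T a x : linear T -> T (a *: x) = a *: T x.
Proof. by move=> linT; have := linT a x 0; rewrite (linear_fun0 linT) !addr0. Qed.

(** Continuity at [0] bounds [T] on a small ball, and homogeneity extends the bound
    to the whole space. *)
Lemma BH_bounded T :
  BH T <-> linear T /\ exists c, forall x, rnorm (T x) <= c * rnorm x.
Proof.
split=> [[linT contT]|[linT [c Tc]]]; split=> //.
  have T0 := linear_fun0 linT.
  have /nbhs_rnormP[e e0 eT] : nbhs (0 : H) (T @^-1` [set y | rnorm y < 1]).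
    apply: contT; rewrite T0; apply/nbhs_rnormP; exists 1 => // w.
    by rewrite subr0.
  exists (2 / e) => x; have [->|x0] := eqVneq x 0.
    by rewrite T0 rnorm0 mulr0.
  have nx0 := rnorm_gt0 x0.
  pose t : R := e / 2 / rnorm x.
  have t0 : 0 < t by rewrite !divr_gt0.
  have /ltW : rnorm (T (t%:C%C *: x)) < 1.
    apply: (eT (_ *: x)); rewrite subr0 rnormZ rnorm_real gtr0_norm //.
    by rewrite divfK ?gt_eqF //; lra.
  rewrite (linear_funZ _ _ linT) rnormZ rnorm_real gtr0_norm // mulrC.
  by rewrite -ler_pdivlMr // div1r /t !invfM !invrK [_^-1 * 2]mulrC.
move=> x A /nbhs_rnormP[e e0 eA]; apply/nbhs_rnormP.
have c0 : 0 < `|c| + 1 by rewrite ltr_wpDl.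
exists (e / (`|c| + 1)); first by rewrite divr_gt0.
move=> w; rewrite ltr_pdivlMr // => wx; apply: eA.
have -> : T w - T x = T (w - x).
  by rewrite -scaleN1r addrC [w - x]addrC -[- x]scaleN1r linT.
apply: le_lt_trans (Tc _) (le_lt_trans _ wx); rewrite [leRHS]mulrC.
by rewrite ler_wpM2r ?rnorm_ge0 // (le_trans (ler_norm _)) // lerDl.
Qed.

Lemma opnorm_le T c : 0 <= c -> (forall x, rnorm (T x) <= c * rnorm x) ->
  opnorm T <= c.
Proof.
move=> c0 Tc; apply: ge_sup.
  by exists (rnorm (T 0)), 0 => //=; rewrite rnorm0.
by move=> _ [x /= x1 <-]; apply: le_trans (Tc x) _; rewrite ler_piMr.
Qed.

Lemma opnorm_has_sup T : BH T ->
  has_sup [set rnorm (T x) | x in [set x : H | rnorm x <= 1]].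
Proof.
move=> /BH_bounded[_ [c Tc]]; split; first by exists (rnorm (T 0)), 0 => //=; rewrite rnorm0.
exists `|c| => _ [x /= x1 <-]; apply: le_trans (Tc x) _.
apply: le_trans (ler_wpM2r (rnorm_ge0 _) (ler_norm _)) _.
by rewrite ler_piMr.
Qed.

Lemma opnorm_ge0 T : BH T -> 0 <= opnorm T.
Proof.
move=> BT; apply: le_trans (rnorm_ge0 (T 0)) _.
by apply: ub_le_sup; [exact: (opnorm_has_sup BT).2|exists 0 => //=; rewrite rnorm0].
Qed.

Lemma opnorm_ub T x : BH T -> rnorm (T x) <= opnorm T * rnorm x.
Proof.
move=> BT; have [linT _] := BT.
have [->|x0] := eqVneq x 0.
  by rewrite (linear_fun0 linT) rnorm0 mulr0.
have nx0 := rnorm_gt0 x0.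
rewrite -ler_pdivrMr //; have := ub_le_sup (opnorm_has_sup BT).2; apply.
have xr : rnorm (rnorm x)^-1%:C%C = (rnorm x)^-1 :> R.
  by rewrite rnorm_real gtr0_norm ?invr_gt0.
exists ((rnorm x)^-1%:C%C *: x).
  by rewrite /= rnormZ xr mulVf ?gt_eqF.
by rewrite (linear_funZ _ _ linT) rnormZ xr mulrC.
Qed.

End BoundedMaps.

(** Bounded operators as a type of their own, which carries the structure of a ring
    for the composition and of a module over the complex numbers. *)
Record bop (R : realType) (H : normedModType R[i]) :=
  Bop { bop_fun :> H -> H; bopP : BH bop_fun }.

HB.instance Definition _ R H := gen_eqMixin (@bop R H).
HB.instance Definition _ R H := gen_choiceMixin (@bop R H).

Section BopRing.
Variables (R : realType) (H : normedModType R[i]).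
Local Notation bop := (bop H).
Implicit Types (F G K : bop) (x y : H) (a : R[i]).

Lemma bop_ext F G : F =1 G -> F = G.
Proof.
case: F G => [f Pf] [g Pg] /= /funext fg; case: g / fg Pg => Pg.
by rewrite (Prop_irrelevance Pf Pg).
Qed.

Lemma bop_linear F : linear F. Proof. exact: (bopP F).1. Qed.

Lemma bop_ub F x : rnorm (F x) <= opnorm F * rnorm x.
Proof. exact: opnorm_ub (bopP F). Qed.

Lemma bop_ge0 F : 0 <= opnorm F. Proof. exact: opnorm_ge0 (bopP F). Qed.

HB.instance Definition _ F :=
  GRing.isLinear.Build R[i] H H *:%R F (bop_linear F).

Fact bop0_subproof : BH (fun=> 0 : H).
Proof.
apply/BH_bounded; split=> [a x y|]; first by rewrite scaler0 addr0.
by exists 0 => x; rewrite mul0r rnorm0.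
Qed.

Fact bop1_subproof : BH (@idfun H).
Proof. by apply/BH_bounded; split=> //; exists 1 => x; rewrite mul1r. Qed.

Fact bopN_subproof F : BH (fun x => - F x).
Proof.
apply/BH_bounded; split=> [a x y|]; first by rewrite linearP opprD scalerN.
by exists (opnorm F) => x; rewrite rnormN bop_ub.
Qed.

Fact bopD_subproof F G : BH (fun x => F x + G x).
Proof.
apply/BH_bounded; split=> [a x y|]; first by rewrite !linearP scalerDr addrACA.
exists (opnorm F + opnorm G) => x; rewrite mulrDl.
by apply: le_trans (ler_rnormD _ _) (lerD _ _); exact: bop_ub.
Qed.

Fact bopM_subproof F G : BH (F \o G).
Proof.
apply/BH_bounded; split=> [a x y|]; first by rewrite /= !linearP.
exists (opnorm F * opnorm G) => x; rewrite -mulrA.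
by apply: le_trans (bop_ub _ _) (ler_wpM2l (bop_ge0 _) (bop_ub _ _)).
Qed.

Fact bopZ_subproof a F : BH (fun x => a *: F x).
Proof.
apply/BH_bounded; split=> [b x y|]; first by rewrite linearP scalerDr !scalerA mulrC.
exists (rnorm a * opnorm F) => x; rewrite rnormZ -mulrA.
by rewrite ler_wpM2l ?rnorm_ge0 ?bop_ub.
Qed.

Definition bop0 := Bop bop0_subproof.
Definition bop1 := Bop bop1_subproof.
Definition bopN F := Bop (bopN_subproof F).
Definition bopD F G := Bop (bopD_subproof F G).
Definition bopM F G := Bop (bopM_subproof F G).
Definition bopZ a F := Bop (bopZ_subproof a F).

Fact bopDA : associative bopD.
Proof. by move=> F G K; apply: bop_ext => x; exact: addrA. Qed.
Fact bopDC : commutative bopD.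
Proof. by move=> F G; apply: bop_ext => x; exact: addrC. Qed.
Fact bop0D : left_id bop0 bopD.
Proof. by move=> F; apply: bop_ext => x; exact: add0r. Qed.
Fact bopND : left_inverse bop0 bopN bopD.
Proof. by move=> F; apply: bop_ext => x; exact: addNr. Qed.
HB.instance Definition _ :=
  GRing.isZmodule.Build bop bopDA bopDC bop0D bopND.

Fact bopMA : associative bopM.
Proof. by move=> F G K; apply: bop_ext. Qed.
Fact bop1M : left_id bop1 bopM.
Proof. by move=> F; apply: bop_ext. Qed.
Fact bopM1 : right_id bop1 bopM.
Proof. by move=> F; apply: bop_ext. Qed.
Fact bopMDl : left_distributive bopM +%R.
Proof. by move=> F G K; apply: bop_ext. Qed.
Fact bopMDr : right_distributive bopM +%R.
Proof. by move=> F G K; apply: bop_ext => x; exact: (linearD F). Qed.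
HB.instance Definition _ :=
  GRing.Zmodule_isPzRing.Build bop bopMA bop1M bopM1 bopMDl bopMDr.

Fact bopZA a b F : bopZ a (bopZ b F) = bopZ (a * b) F.
Proof. by apply: bop_ext => x; exact: scalerA. Qed.
Fact bop1Z : left_id 1 bopZ.
Proof. by move=> F; apply: bop_ext => x; exact: scale1r. Qed.
Fact bopZDr : right_distributive bopZ +%R.
Proof. by move=> a F G; apply: bop_ext => x; exact: scalerDr. Qed.
Fact bopZDl F : {morph bopZ^~ F : a b / a + b}.
Proof. by move=> a b; apply: bop_ext => x; exact: scalerDl. Qed.
HB.instance Definition _ :=
  GRing.Zmodule_isLmodule.Build R[i] bop bopZA bop1Z bopZDr bopZDl.

Lemma bopDE F G x : (F + G) x = F x + G x. Proof. by []. Qed.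
Lemma bopNE F x : (- F) x = - F x. Proof. by []. Qed.
Lemma bopBE F G x : (F - G) x = F x - G x. Proof. by []. Qed.
Lemma bopME F G x : (F * G) x = F (G x). Proof. by []. Qed.
Lemma bopZE a F x : (a *: F) x = a *: F x. Proof. by []. Qed.
Lemma bop1E x : (1 : bop) x = x. Proof. by []. Qed.
Lemma bop0E x : (0 : bop) x = 0. Proof. by []. Qed.

Lemma bop_sumE (I : Type) (r : seq I) (P : pred I) (F_ : I -> bop) x :
  (\sum_(i <- r | P i) F_ i) x = \sum_(i <- r | P i) F_ i x.
Proof. by elim/big_rec2: _ => // i y G _ <-. Qed.

Lemma bopXE F n x : (F ^+ n) x = iter n F x.
Proof. by elim: n x => // n IH x; rewrite exprS bopME IH. Qed.

Lemma scale_bopAl a F G : a *: (F * G) = (a *: F) * G.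
Proof. exact: bop_ext. Qed.

Lemma scale_bopAr a F G : a *: (F * G) = F * (a *: G).
Proof. by apply: bop_ext => x; rewrite !(bopZE, bopME) linearZ. Qed.

(** [opnorm] on the bundled type, whose lemmas need no boundedness side condition. *)
Definition nrm F : R := opnorm F.

Lemma nrm_le F c : 0 <= c -> (forall x, rnorm (F x) <= c * rnorm x) -> nrm F <= c.
Proof. exact: opnorm_le. Qed.

Lemma nrm_ub F x : rnorm (F x) <= nrm F * rnorm x.
Proof. exact: bop_ub. Qed.

Lemma nrm_ge0 F : 0 <= nrm F.
Proof. exact: bop_ge0. Qed.

Lemma nrm_eq0 F : nrm F <= 0 -> F = 0.
Proof.
move=> F0; apply: bop_ext => x; apply: rnorm_eq0; apply/le_anti.
rewrite rnorm_ge0 andbT; apply: le_trans (nrm_ub _ _) _.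
by rewrite mulr_le0_ge0 ?rnorm_ge0.
Qed.

Lemma nrm0 : nrm 0 = 0.
Proof.
apply/le_anti; rewrite nrm_ge0 andbT; apply: nrm_le => // x.
by rewrite bop0E rnorm0 mul0r.
Qed.

Lemma nrm1_le : nrm 1 <= 1.
Proof. by apply: nrm_le => // x; rewrite mul1r. Qed.

Lemma ler_nrmD F G : nrm (F + G) <= nrm F + nrm G.
Proof.
apply: nrm_le => [|x]; first by rewrite addr_ge0 ?nrm_ge0.
by rewrite mulrDl; apply: le_trans (ler_rnormD _ _) (lerD _ _); exact: nrm_ub.
Qed.

Lemma ler_nrmM F G : nrm (F * G) <= nrm F * nrm G.
Proof.
apply: nrm_le => [|x]; first by rewrite mulr_ge0 ?nrm_ge0.
rewrite -mulrA.
by apply: le_trans (nrm_ub _ _) (ler_wpM2l (nrm_ge0 _) (nrm_ub _ _)).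
Qed.

Lemma ler_nrmMM F G c d : nrm F <= c -> nrm G <= d -> nrm (F * G) <= c * d.
Proof.
by move=> Fc Gd; apply: le_trans (ler_nrmM _ _) (ler_pM _ _ Fc Gd); exact: nrm_ge0.
Qed.

Lemma ler_nrmZ a F : nrm (a *: F) <= rnorm a * nrm F.
Proof.
apply: nrm_le => [|x]; first by rewrite mulr_ge0 ?nrm_ge0 ?rnorm_ge0.
by rewrite bopZE rnormZ -mulrA ler_wpM2l ?rnorm_ge0 ?nrm_ub.
Qed.

Lemma nrmN F : nrm (- F) = nrm F.
Proof.
suff le G : nrm (- G) <= nrm G by apply/le_anti; rewrite le -{1}(opprK F) le.
by apply: nrm_le => [|x]; rewrite ?nrm_ge0 // bopNE rnormN nrm_ub.
Qed.

Lemma nrmBC F G : nrm (F - G) = nrm (G - F).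
Proof. by rewrite -nrmN opprB. Qed.

Lemma ler_nrmB F G : nrm (F - G) <= nrm F + nrm G.
Proof. by rewrite -(nrmN G) ler_nrmD. Qed.

Lemma ler_nrmX F n : nrm (F ^+ n) <= nrm F ^+ n.
Proof.
elim: n => [|n IH]; first exact: nrm1_le.
by rewrite !exprS ler_nrmMM.
Qed.

Lemma ler_nrm_sum (I : Type) (r : seq I) (P : pred I) (F_ : I -> bop) :
  nrm (\sum_(i <- r | P i) F_ i) <= \sum_(i <- r | P i) nrm (F_ i).
Proof.
elim/big_ind2: _ => [|x a y b xa yb|//]; first by rewrite nrm0.
exact: le_trans (ler_nrmD _ _) (lerD xa yb).
Qed.

Lemma nrm_small F : (forall e : R, 0 < e -> nrm F <= e) -> F = 0.
Proof.
move=> Fe; apply: nrm_eq0; apply/ler_addgt0Pr => e e0; rewrite add0r; exact: Fe.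
Qed.

End BopRing.

(** Convergence in operator norm, stated directly: [bop H] carries no topology. *)
Definition nrm_lim (R : realType) (H : normedModType R[i])
    (u : nat -> bop H) (L : bop H) :=
  forall e : R, 0 < e -> exists N, forall n, (N <= n)%N -> nrm (u n - L) <= e.

Section BopLimits.
Variables (R : realType) (H : normedModType R[i]).
Implicit Types (u v : nat -> bop H) (F G : bop H).

Lemma nrm_lim_unique u F G : nrm_lim u F -> nrm_lim u G -> F = G.
Proof.
move=> uF uG; apply/eqP; rewrite -subr_eq0; apply/eqP/nrm_small => e e0.
have e2 : 0 < e / 2 by rewrite divr_gt0.
have [N NP] := uF _ e2; have [M MP] := uG _ e2.
have FN := NP _ (leq_maxl N M); have GM := MP _ (leq_maxr N M).
rewrite -(subrKA (u (maxn N M))) [leRHS]splitr.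
by apply: le_trans (ler_nrmD _ _) (lerD _ _) => //; rewrite nrmBC.
Qed.

Lemma nrm_lim_cst F : nrm_lim (fun=> F) F.
Proof. by move=> e e0; exists 0 => n _; rewrite subrr nrm0 ltW. Qed.

Lemma nrm_limM u v F G : nrm_lim u F -> nrm_lim v G ->
  nrm_lim (fun n => u n * v n) (F * G).
Proof.
move=> uF vG e e0; pose c := nrm F + nrm G + 1.
have c0 : 0 < c by rewrite ltr_wpDl // addr_ge0 ?nrm_ge0.
have ec0 : 0 < Num.min 1 (e / 2 / c) by rewrite lt_min ltr01 !divr_gt0.
have [N NP] := uF _ ec0; have [M MP] := vG _ ec0.
exists (maxn N M) => n; rewrite geq_max => /andP[/NP FN /MP GM].
have -> : u n * v n - F * G = (u n - F) * v n + F * (v n - G).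
  by rewrite mulrBl mulrBr addrA subrK.
move: FN; rewrite le_min => /andP[_ FN]; move: GM; rewrite le_min => /andP[GM1 GM].
have vn : nrm (v n) <= nrm G + 1.
  by rewrite -(subrK G (v n)); apply: le_trans (ler_nrmD _ _) _; rewrite addrC lerD2l.
apply: le_trans (ler_nrmD _ _) _.
apply: le_trans (lerD (ler_nrmMM FN vn) (ler_nrmMM (lexx _) GM)) _.
rewrite [nrm F * _]mulrC -mulrDr.
have e2c : 0 <= e / 2 / c by rewrite !divr_ge0 // ltW.
have le2c : nrm G + 1 + nrm F = c by rewrite /c; ring.
by rewrite le2c divfK ?gt_eqF //; lra.
Qed.

End BopLimits.

Section BopComplete.
Variables (R : realType) (H : completeNormedModType R[i]).
Local Notation bop := (bop H).

Lemma rnorm_complete (u : nat -> H) :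
  (forall e : R, 0 < e ->
     exists N, forall n, (N <= n)%N -> rnorm (u n - u N) < e) ->
  exists l, forall e : R, 0 < e ->
     exists N, forall n, (N <= n)%N -> rnorm (u n - l) < e.
Proof.
move=> uC; suff /cvg_ex[l /cvgn_rnormP ul] : cvg (u n @[n --> \oo]).
  by exists l => e /ul /nearooP.
apply: cauchy_cvg; apply: cauchy_exP => e e0.
have [eE e0'] := posC_Re e0; have [N uN] := uC _ e0'.
exists (u N); exists N => // n /= Nn.
by rewrite -ball_normE /ball_ /= eE distrC rnormE ltcR uN.
Qed.

(** The pointwise limits of a Cauchy sequence of operators form an operator, and the
    convergence is uniform on the unit ball. *)
Lemma nrm_complete (u : nat -> bop) :
  (forall e : R, 0 < e -> exists N, forall m n, (N <= m)%N -> (N <= n)%N ->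
     nrm (u m - u n) <= e) ->
  exists L, nrm_lim u L.
Proof.
move=> uC.
have /choice[l lP] x : exists l, forall e : R, 0 < e ->
     exists N, forall n, (N <= n)%N -> rnorm (u n x - l) < e.
  apply: rnorm_complete => e e0.
  have c0 : 0 < rnorm x + 1 by rewrite ltr_wpDl ?rnorm_ge0.
  have [N uN] := uC (e / (rnorm x + 1)) (divr_gt0 e0 c0).
  exists N => n Nn; rewrite -bopBE; apply: le_lt_trans (nrm_ub _ _) _.
  apply: (@le_lt_trans _ _ (e / (rnorm x + 1) * rnorm x)).
    by rewrite ler_wpM2r ?rnorm_ge0 ?uN.
  by rewrite mulrAC ltr_pdivrMr // ltr_pM2l // ltrDl.
have lin_l : linear l.
  move=> a x y; apply/eqP; rewrite -subr_eq0; apply/eqP/rnorm_eq0/le_anti.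
  rewrite rnorm_ge0 andbT; apply/ler_addgt0Pr => e e0; rewrite add0r.
  have a0 : 0 < rnorm a + 2 by rewrite ltr_wpDl ?rnorm_ge0.
  have [N1 N1P] := lP (a *: x + y) _ (divr_gt0 e0 a0).
  have [N2 N2P] := lP x _ (divr_gt0 e0 a0).
  have [N3 N3P] := lP y _ (divr_gt0 e0 a0).
  pose N := maxn N1 (maxn N2 N3).
  have /N1P/ltW P1 : (N1 <= N)%N by rewrite leq_max leqnn.
  have /N2P/ltW P2 : (N2 <= N)%N by rewrite !leq_max leqnn orbT.
  have /N3P/ltW P3 : (N3 <= N)%N by rewrite !leq_max leqnn !orbT.
  have -> : l (a *: x + y) - (a *: l x + l y) =
      - (u N (a *: x + y) - l (a *: x + y)) +
      (a *: (u N x - l x) + (u N y - l y)).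
    rewrite [u N (a *: x + y)]linearP scalerBr opprB; set p := a *: u N x; set q := u N y.
    by rewrite [p - _ + _]addrACA -opprD subrKA.
  apply: le_trans (ler_rnormD _ _) _; rewrite rnormN.
  have P4 : rnorm (a *: (u N x - l x)) <= rnorm a * (e / (rnorm a + 2)).
    by rewrite rnormZ ler_wpM2l ?rnorm_ge0.
  apply: le_trans (lerD P1 (le_trans (ler_rnormD _ _) (lerD P4 P3))) _.
  have -> : e / (rnorm a + 2) + (rnorm a * (e / (rnorm a + 2)) + e / (rnorm a + 2))
      = e / (rnorm a + 2) * (rnorm a + 2) by ring.
  by rewrite divfK ?gt_eqF.
have ul e x N : (forall m n, (N <= m)%N -> (N <= n)%N -> nrm (u m - u n) <= e) ->
    forall n, (N <= n)%N -> rnorm (u n x - l x) <= e * rnorm x.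
  move=> uN n Nn; apply/ler_addgt0Pr => d d0.
  have [M MP] := lP x _ d0.
  have /MP/ltW MP' : (M <= maxn M N)%N by rewrite leq_maxl.
  apply: le_trans (ler_rdistD (u (maxn M N) x) _ _) (lerD _ MP').
  rewrite -bopBE; apply: le_trans (nrm_ub _ _) (ler_wpM2r (rnorm_ge0 _) _).
  by rewrite uN // leq_maxr.
have BHl : BH l.
  apply/BH_bounded; split=> //; have [N uN] := uC 1 ltr01.
  exists (nrm (u N) + 1) => x; rewrite mulrDl.
  rewrite -[l x](subKr (u N x)); apply: le_trans (ler_rnormB _ _) (lerD _ _).
    exact: nrm_ub.
  exact: ul uN _ (leqnn _).
exists (Bop BHl) => e e0; have [N uN] := uC e e0; exists N => n Nn.
by apply: nrm_le => [|x]; [exact: ltW|rewrite bopBE /=; exact: ul uN _ Nn].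
Qed.

(** The inverse is the sum of the Neumann series, the powers of [K]. *)
Lemma neumann (K : bop) : nrm K < 1 -> exists S, S * (1 - K) = 1 /\ (1 - K) * S = 1.
Proof.
move=> K1; pose u n := \sum_(i < n) K ^+ i.
have powK (e : R) : 0 < e -> exists N, forall n, (N <= n)%N -> nrm K ^+ n <= e.
  move=> e0; have := @cvg_expr R (nrm K); rewrite ger0_norm ?nrm_ge0 // => /(_ K1).
  move=> /cvgrPdist_le /(_ e e0) /nearooP[N NP]; exists N => n /NP.
  by rewrite sub0r normrN ger0_norm // exprn_ge0 ?nrm_ge0.
have q0 : 0 < 1 - nrm K by rewrite subr_gt0.
have geoR : forall n, (1 - K) * u n = 1 - K ^+ n.
  by move=> n; rewrite -[1 - K]opprB mulNr -subrX1 opprB.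
have geoL : forall n, u n * (1 - K) = 1 - K ^+ n.
  move=> n; rewrite -geoR /u mulrBl mulrBr mul1r mulr1 mulr_sumr mulr_suml.
  by congr (_ - _); apply: eq_bigr => i _; rewrite -exprS -exprSr.
have uD m k : nrm (u (m + k)%N - u m) <= nrm K ^+ m / (1 - nrm K).
  rewrite /u big_split_ord /= [X in X - _]addrC addrK.
  apply: le_trans (ler_nrm_sum _ _ _) _.
  apply: (@le_trans _ _ (\sum_(i < k) nrm K ^+ m * nrm K ^+ i)).
    by apply: ler_sum => i _; rewrite -exprD ler_nrmX.
  rewrite -mulr_sumr ler_wpM2l ?exprn_ge0 ?nrm_ge0 //.
  rewrite -[X in X <= _]mul1r -[X in X * _](@divff _ (1 - nrm K)) ?gt_eqF // mulrAC.
  rewrite -[X in X / _]opprK -mulNr opprB -subrX1 opprB ler_pdivrMr // mulVf ?gt_eqF //.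
  by rewrite gerBl exprn_ge0 // nrm_ge0.
have [e e0|S SP] := @nrm_complete u.
  have [N NP] := powK (e * (1 - nrm K) / 2) ltac:(by rewrite divr_gt0 ?mulr_gt0).
  have uN k : nrm (u (N + k)%N - u N) <= e / 2.
    apply: le_trans (uD _ _) _; rewrite ler_pdivrMr // mulrAC; exact: NP.
  exists N => m n /subnKC<- /subnKC<-.
  rewrite -(subrKA (u N)); apply: le_trans (ler_nrmD _ _) _.
  by rewrite [X in _ + X]nrmBC [leRHS]splitr lerD.
have limK : nrm_lim (fun n => 1 - K ^+ n) 1.
  move=> e /powK[N NP]; exists N => n /NP; rewrite addrAC subrr add0r nrmN.
  exact/le_trans/ler_nrmX.
have lim1K : nrm_lim (fun=> 1 - K) (1 - K) by exact: nrm_lim_cst.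
exists S; split; apply: nrm_lim_unique limK.
  have -> : (fun n => 1 - K ^+ n) = (fun n => u n * (1 - K)) by apply/funext.
  exact: nrm_limM.
have -> : (fun n => 1 - K ^+ n) = (fun n => (1 - K) * u n) by apply/funext.
exact: nrm_limM.
Qed.

End BopComplete.

(** * Spectra and polynomials in one operator *)

Section PolynomialCalculus.
Variables (R : realType) (H : normedModType R[i]).
Local Notation bop := (bop H).
Implicit Types (T F G : bop) (p q : {poly R[i]}).

(** The values [opeval p T], as elements of the algebra of bounded operators. *)
Definition hev p T : bop := \sum_(k < size p) p`_k *: T ^+ k.

Lemma hevE p T : hev p T = opeval p T :> (H -> H).
Proof.
by apply/funext => x; rewrite /hev bop_sumE; apply: eq_bigr => k _; rewrite bopZE bopXE.
Qed.

Lemma hev_wide p T n : (size p <= n)%N -> hev p T = \sum_(k < n) p`_k *: T ^+ k.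
Proof.
move=> pn; rewrite /hev (big_ord_widen n (fun k => p`_k *: T ^+ k) pn) big_mkcond /=.
apply: eq_bigr => k _; case: ltnP => // pk.
by rewrite nth_default // scale0r.
Qed.

Lemma hevD p q T : hev (p + q) T = hev p T + hev q T.
Proof.
pose n := maxn (size p) (size q).
rewrite (@hev_wide p T n) ?leq_maxl // (@hev_wide q T n) ?leq_maxr //.
rewrite (@hev_wide (p + q) T n) ?size_polyD // -big_split /=.
by apply: eq_bigr => k _; rewrite coefD scalerDl.
Qed.

Lemma hevZ a p T : hev (a *: p) T = a *: hev p T.
Proof.
rewrite (@hev_wide _ T (size p)) ?size_scale_leq // /hev scaler_sumr.
by apply: eq_bigr => k _; rewrite coefZ scalerA.
Qed.

Lemma hev0 T : hev 0 T = 0.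
Proof. by rewrite /hev size_poly0 big_ord0. Qed.

Lemma hevC a T : hev a%:P T = a *: (1 : bop).
Proof. by rewrite (@hev_wide _ T 1) ?size_polyC_leq1 // big_ord1 coefC. Qed.

Lemma hevMX p T : hev (p * 'X) T = hev p T * T.
Proof.
rewrite (@hev_wide _ T (size p).+1); last first.
  by rewrite (leq_trans (size_polyMleq _ _)) // size_polyX addn2.
rewrite big_ord_recl coefMX eqxx scale0r add0r /hev mulr_suml.
by apply: eq_bigr => k _; rewrite coefMX /= -scale_bopAl exprSr.
Qed.

Lemma hevX T : hev 'X T = T.
Proof. by rewrite -['X]mul1r hevMX hevC scale1r mul1r. Qed.

Lemma hevN p T : hev (- p) T = - hev p T.
Proof. by rewrite -scaleN1r hevZ scaleN1r. Qed.

Lemma hevB p q T : hev (p - q) T = hev p T - hev q T.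
Proof. by rewrite hevD hevN. Qed.

Lemma hev_sum (I : Type) (r : seq I) (P : pred I) (F : I -> {poly R[i]}) T :
  hev (\sum_(i <- r | P i) F i) T = \sum_(i <- r | P i) hev (F i) T.
Proof. by apply: (big_morph (hev^~ T)) => [p q|]; rewrite ?hevD ?hev0. Qed.

Lemma comm_hev F p T : GRing.comm F T -> GRing.comm F (hev p T).
Proof.
move=> FT; rewrite /hev; apply: commr_sum => k _.
by rewrite /GRing.comm -scale_bopAr -scale_bopAl (commrX k FT).
Qed.

Lemma hevM p q T : hev (p * q) T = hev p T * hev q T.
Proof.
elim/poly_ind: q => [|q c IH]; first by rewrite mulr0 !hev0 mulr0.
rewrite mulrDr mulrA !hevD !hevMX IH mulrDr mulrA; congr (_ + _).
by rewrite mulrC mul_polyC hevZ hevC -scale_bopAr mulr1.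
Qed.

Lemma hev_comm p q T : GRing.comm (hev p T) (hev q T).
Proof. by rewrite /GRing.comm -!hevM mulrC. Qed.

Definition binv F := exists G, G * F = 1 /\ F * G = 1.

Lemma spectrumP T z : spectrum T z <-> ~ binv (T - z *: (1 : bop)).
Proof.
split=> zT; apply: contra_not zT => -[S].
  move=> [ST TS]; exists S; split=> [|x|x]; first exact: bopP.
    by have /(congr1 (fun F : bop => F x)) := ST.
  by have /(congr1 (fun F : bop => F x)) := TS.
move=> [BS ST TS]; exists (Bop BS); split; apply: bop_ext => x; first exact: ST.
exact: TS.
Qed.

Lemma binv1 : binv 1.
Proof. by exists 1; rewrite mulr1. Qed.

Lemma binvM F G : binv F -> binv G -> binv (F * G).
Proof.
move=> [F' [lF rF]] [G' [lG rG]]; exists (G' * F'); split.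
  by rewrite mulrA -(mulrA G') lF mulr1.
by rewrite mulrA -(mulrA F) rG mulr1.
Qed.

(** If [S] inverts [F * G], then [S * G] is a left inverse of [F] and [G * S] a right
    inverse, so that they coincide. *)
Lemma binv_comm_factor F G : GRing.comm F G -> binv (F * G) -> binv F.
Proof.
move=> FG [S [SFG FGS]].
have GSl : S * G * F = 1 by rewrite -mulrA -[G * F]FG.
have FSr : F * (G * S) = 1 by rewrite mulrA.
have e : S * G = G * S by rewrite -[LHS]mulr1 -FSr mulrA GSl mul1r.
by exists (S * G); split=> //; rewrite e.
Qed.

Lemma binvZ a F : a != 0 -> binv F -> binv (a *: F).
Proof.
move=> a0 [G [GF FG]]; exists (a^-1 *: G).
by rewrite -!scale_bopAl -!scale_bopAr GF FG !scalerA mulVf // divff // scale1r.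
Qed.

(** If [z] is in the spectrum of [T], then [T - z] is a commuting factor of
    [p(T) - p(z)]. Conversely [p - w] splits into linear factors [X - z], and
    [p(T) - w] is invertible if all the [T - z] are. *)
Lemma spectral_mapping p T : (1 < size p)%N ->
  spectrum (hev p T) = [set p.[z] | z in spectrum T].
Proof.
move=> p1; apply/seteqP; split=> [w|_ [z /spectrumP Tz <-]]; last first.
  apply/spectrumP; apply: contra_not Tz.
  have /factor_theorem[q qE] : root (p - (p.[z])%:P) z.
    by rewrite rootE !hornerE subrr.
  have -> : hev p T - p.[z] *: (1 : bop) = (T - z *: (1 : bop)) * hev q T.
    by rewrite -(hevC _ T) -hevB qE mulrC hevM hevB hevX hevC.
  apply: binv_comm_factor; rewrite -[T in T - _]hevX -(hevC _ T) -hevB; exact: hev_comm.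
move=> /spectrumP pw; apply: contrapT => npw; apply: pw.
have [r rE] := closed_field_poly_normal (p - w%:P).
have pw1 : size (p - w%:P) = size p.
  by rewrite size_polyDl // size_polyN (leq_ltn_trans (size_polyC_leq1 _)).
have lc0 : lead_coef (p - w%:P) != 0.
  by rewrite lead_coef_eq0 -size_poly_gt0 pw1 ltnW.
rewrite -(hevC _ T) -hevB rE hevZ; apply: binvZ => //.
have : {in r, forall z, p.[z] = w}.
  move=> z zr; apply/eqP; rewrite -subr_eq0.
  have -> : p.[z] - w = (p - w%:P).[z] by rewrite !hornerE.
  rewrite rE hornerZ (big_rem z) //= hornerM hornerXsubC subrr mul0r mulr0 //.
elim: r {rE} => [|z r IH] rw; first by rewrite big_nil hevC scale1r; exact: binv1.
rewrite big_cons hevM; apply: binvM; last first.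
  by apply: IH => y yr; rewrite rw // inE yr orbT.
rewrite hevB hevX hevC; apply: contrapT => zT; apply: npw; exists z.
  exact/spectrumP.
by rewrite rw // mem_head.
Qed.

End PolynomialCalculus.

Section CompactPlane.
Variable R : realType.
Implicit Types (K : set R[i]) (f : R[i] -> R[i]).

(** [K] is a closed subset of a square, the continuous image of a product of
    compact intervals. *)
Lemma compact_plane K (c : R) :
  (forall z, K z -> rnorm z <= c) -> closed K -> compact K.
Proof.
move=> Kc clK; pose g (x : R * R) : R[i] := (x.1 +i* x.2)%C.
have contg : continuous g.
  move=> [a b] A /nbhs_rnormP[e e0 eA].
  have e2 : 0 < e / 2 by rewrite divr_gt0.
  have ballA (a' b' : R) : `|a - a'| < e / 2 -> `|b - b'| < e / 2 -> A (g (a', b')).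
    move=> aa bb; apply: eA.
    have -> : g (a', b') - g (a, b) = (a' - a)%:C%C + 'i%C * (b' - b)%:C%C.
      by apply/eqP; rewrite eq_complex /=; apply/andP; split; apply/eqP; rewrite /=; ring.
    apply: le_lt_trans (ler_rnormD _ _) _; rewrite rnormM !rnorm_real.
    rewrite [rnorm 'i%C]rnormCE /= expr0n expr1n add0r sqrtr1 mul1r.
    by rewrite [e]splitr distrC [`|b' - b|]distrC ltrD.
  exists (ball a (e / 2), ball b (e / 2)); first by split; exact: nbhsx_ballx.
  by move=> [a' b'] [/= aa bb]; exact: ballA.
have cKK : compact (g @` (`[- c, c]%classic `*` `[- c, c]%classic)).
  apply: continuous_compact; first exact: continuous_subspaceT.
  by apply: compact_setX; exact: segment_compact.
apply: (subclosed_compact clK cKK) => z /Kc zc.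
exists (complex.Re z, complex.Im z); last by case: z {zc}.
split; rewrite /= in_itv /= -ler_norml; apply: le_trans zc.
  exact: ler_rnorm_Re.
exact: ler_rnorm_Im.
Qed.

Lemma within_rnormP K f z : {within K, continuous f} -> K z ->
  forall e : R, 0 < e -> exists2 r : R, 0 < r &
    forall w, K w -> rnorm (w - z) < r -> rnorm (f w - f z) < e.
Proof.
move=> cf Kz e e0.
have : nbhs (z : subspace K) (f @^-1` [set y | rnorm (y - f z) < e]).
  by apply: (cf z); apply/nbhs_rnormP; exists e.
rewrite /nbhs /= -(nbhs_subspace_in Kz) => /nbhs_rnormP[r r0 rP].
by exists r => // w Kw wr; exact: rP.
Qed.

Lemma compact_unif_cont K f : compact K -> {within K, continuous f} ->
  forall e : R, 0 < e -> exists2 r : R, 0 < r &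
    forall z w, K z -> K w -> rnorm (z - w) < r -> rnorm (f z - f w) < e.
Proof.
move=> /compact_near_coveringP cK cf e e0.
have /cK : forall z, K z -> \forall z' \near z & r \near (0 : R)^'+,
    K z' -> forall w, K w -> rnorm (z' - w) < r -> rnorm (f z' - f w) < e.
  move=> z Kz; have e2 : 0 < e / 2 by rewrite divr_gt0.
  have [r r0 rP] := within_rnormP cf Kz e2.
  have r2 : 0 < r / 2 by rewrite divr_gt0.
  exists ([set z' | rnorm (z' - z) < r / 2], [set r' | r' < r / 2]).
    split; first by apply/nbhs_rnormP; exists (r / 2).
    exact: nbhs_right_lt.
  move=> [z' r'] [/= zz rr] Kz' w Kw zw.
  have wz : rnorm (w - z) < r.
    rewrite [r]splitr; apply: le_lt_trans (ler_rdistD z' _ _) _.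
    by rewrite ltrD // rdistC (lt_trans zw).
  rewrite [e]splitr; apply: le_lt_trans (ler_rdistD (f z) _ _) _.
  rewrite ltrD //; last by rewrite rdistC rP.
  by rewrite rP // (lt_trans zz) // ltr_pdivrMr // mulr_natr mulr2n ltrDl.
move=> Kf; have [r [Kr r0]] := filter_ex (filterI Kf (nbhs_right_gt 0)).
by exists r => // z w Kz; exact: Kr.
Qed.

Lemma compact_bounded_fun K f : compact K -> {within K, continuous f} ->
  exists M : R, forall z, K z -> rnorm (f z) <= M.
Proof.
move=> /compact_near_coveringP cK cf.
have /cK : forall z, K z -> \forall z' \near z & M \near +oo,
    K z' -> rnorm (f z') <= M.
  move=> z Kz; have [r r0 rP] := within_rnormP cf Kz ltr01.
  exists ([set z' | rnorm (z' - z) < r], [set M | rnorm (f z) + 1 <= M]).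
    split; first by apply/nbhs_rnormP; exists r.
    by apply: nbhs_pinfty_ge; exact: num_real.
  move=> [z' M] [/= zz MM] Kz'; apply: le_trans MM; rewrite addrC -lerBlDr.
  exact: le_trans (ler_rnorm_sub _ _) (ltW (rP _ Kz' zz)).
move=> Kf; have [M KM] := filter_ex Kf.
by exists M => z Kz; exact: KM.
Qed.

End CompactPlane.

Section CompactSpectrum.
Variables (R : realType) (H : completeNormedModType R[i]).
Local Notation bop := (bop H).
Implicit Types (T S D : bop).

(** By the Neumann series, because [T - D = T * (1 - S * D)]. *)
Lemma binv_perturb T S D : S * T = 1 -> T * S = 1 -> nrm S * nrm D < 1 ->
  binv (T - D).
Proof.
move=> ST TS SD; have -> : T - D = T * (1 - S * D).
  by rewrite mulrBr mulr1 mulrA TS mul1r.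
apply: binvM; first by exists S.
have [G ?] := neumann (le_lt_trans (ler_nrmM S D) SD); by exists G.
Qed.

(** If [z] exceeds the norm of [T], then [T - z] is a small perturbation of [- z]. *)
Lemma spectrum_le T z : spectrum T z -> rnorm z <= nrm T.
Proof.
move=> /spectrumP zT; rewrite leNgt; apply/negP => Tz; apply: zT.
have z0 : z != 0.
  by apply: contraTneq Tz => ->; rewrite rnorm0 -leNgt nrm_ge0.
rewrite -opprB -scaleN1r; apply: binvZ; first by rewrite oppr_eq0 oner_eq0.
have nz : 0 < rnorm z by exact: rnorm_gt0.
apply: (@binv_perturb _ (z^-1 *: (1 : bop))).
- by rewrite -scale_bopAl mul1r scalerA mulVf // scale1r.
- by rewrite -scale_bopAl mul1r scalerA divff // scale1r.
apply: (@le_lt_trans _ _ ((rnorm z)^-1 * nrm T)).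
  rewrite ler_wpM2r ?nrm_ge0 // -rnormV -[leRHS]mulr1.
  by apply: le_trans (ler_nrmZ _ _) _; rewrite ler_wpM2l ?rnorm_ge0 ?nrm1_le.
by rewrite mulrC ltr_pdivrMr // mul1r.
Qed.

Lemma closed_spectrum T : closed (spectrum T).
Proof.
rewrite -[X in closed X]setCK; apply: open_closedC; rewrite openE => z.
rewrite /= => nTz; have [S [lS rS]] : binv (T - z *: (1 : bop)).
  by apply: contrapT => /spectrumP.
have S0 : 0 < nrm S + 1 by rewrite ltr_wpDl ?nrm_ge0.
apply/nbhs_rnormP; exists (nrm S + 1)^-1; first by rewrite invr_gt0.
move=> w wz /spectrumP; apply.
have -> : T - w *: (1 : bop) = (T - z *: (1 : bop)) - (w - z) *: (1 : bop).
  by rewrite scalerBl opprB addrA subrK.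
apply: binv_perturb lS rS _.
apply: (@le_lt_trans _ _ (nrm S * (nrm S + 1)^-1)).
  rewrite ler_wpM2l ?nrm_ge0 //; apply: le_trans (ler_nrmZ _ _) _.
  rewrite -[leRHS]mulr1; apply: ler_pM; rewrite ?rnorm_ge0 ?nrm_ge0 ?nrm1_le //.
  exact: ltW.
by rewrite ltr_pdivrMr // mul1r ltrDl.
Qed.

Lemma compact_spectrum T : compact (spectrum T).
Proof. exact: compact_plane (@spectrum_le T) (@closed_spectrum T). Qed.

End CompactSpectrum.

(** * Hilbert spaces and adjoints *)

Section InnerProduct.
Variables (R : realType) (H : normedModType R[i]).
Variable ip : {dot H for @Num.conj R[i]}.
Hypothesis ip_norm : forall x : H, `|x| ^+ 2 = ip x x.
Implicit Types (x y u v : H) (a : R[i]).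

Lemma ipDl x y u : ip (x + y) u = ip x u + ip y u. Proof. exact: linearDl. Qed.
Lemma ipDr x y u : ip x (y + u) = ip x y + ip x u. Proof. exact: linearDr. Qed.
Lemma ipNl x u : ip (- x) u = - ip x u. Proof. exact: linearNl. Qed.
Lemma ipNr x u : ip x (- u) = - ip x u. Proof. exact: linearNr. Qed.
Lemma ipBl x y u : ip (x - y) u = ip x u - ip y u. Proof. exact: linearBl. Qed.
Lemma ipBr x y u : ip x (y - u) = ip x y - ip x u. Proof. exact: linearBr. Qed.
Lemma ipZl a x u : ip (a *: x) u = a * ip x u. Proof. exact: linearZl_LR. Qed.
Lemma ipZr a x u : ip x (a *: u) = a^* * ip x u. Proof. exact: linearZr_LR. Qed.
Lemma ipC x y : ip x y = (ip y x)^*.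
Proof. by rewrite (hermitian_subproof x y) expr0 mul1r. Qed.

Lemma ip_rnorm x : ip x x = (rnorm x ^+ 2)%:C%C.
Proof. by rewrite -ip_norm rnormE rmorphXn. Qed.

Lemma Re_ipC x y : complex.Re (ip x y) = complex.Re (ip y x).
Proof. by rewrite ipC; case: (ip y x). Qed.

Lemma rnormD_sqr x y :
  rnorm (x + y) ^+ 2 = rnorm x ^+ 2 + rnorm y ^+ 2 + 2 * complex.Re (ip x y).
Proof.
have := congr1 (@complex.Re R) (ip_rnorm (x + y)).
rewrite ipDl !ipDr !ip_rnorm !raddfD /= => <-.
by rewrite (Re_ipC y x); ring.
Qed.

(** Expand the square of the norm of [|y|^2 x - ip x y y]. *)
Lemma CauchySchwarz x y : rnorm (ip x y) <= rnorm x * rnorm y.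
Proof.
have [->|y0] := eqVneq y 0; first by rewrite [ip x 0]linear0r !rnorm0 mulr0.
have ny := rnorm_gt0 y0.
set a := ip x y; set Y := (rnorm y ^+ 2)%:C%C.
have YE : Y^* = Y by exact: conjc_real.
have aa : a * a^* = (rnorm a ^+ 2)%:C%C.
  by rewrite -normCK rnormE rmorphXn.
have : 0 <= ip (Y *: x - a *: y) (Y *: x - a *: y).
  by rewrite ip_rnorm ler0c sqr_ge0.
rewrite ipBl !ipBr !ipZl !ipZr (ipC y x) -/a !ip_rnorm YE -/Y.
have -> : Y * (Y * (rnorm x ^+ 2)%:C%C) - Y * (a^* * a) -
    (a * (Y * a^*) - a * (a^* * Y)) =
    Y * (Y * (rnorm x ^+ 2)%:C%C - a * a^*) by ring.
rewrite aa /Y -!(rmorphM, rmorphB) /= -exprMn [rnorm y * _]mulrC.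
rewrite ler0c pmulr_rge0 ?exprn_gt0 // subr_ge0 ler_pXn2r // nnegrE //.
  exact: rnorm_ge0.
by rewrite mulr_ge0 ?rnorm_ge0.
Qed.

Lemma ip_eq x y : (forall u, ip u x = ip u y) -> x = y.
Proof.
move=> xy; apply/eqP; rewrite -subr_eq0; apply/eqP/rnorm_eq0.
have /eqP : ip (x - y) (x - y) = 0 by rewrite ipBr xy subrr.
by rewrite ip_rnorm eq_complex /= eqxx andbT sqrf_eq0 => /eqP.
Qed.

End InnerProduct.

Section Riesz.
Variables (R : realType) (H : completeNormedModType R[i]).
Variable ip : {dot H for @Num.conj R[i]}.
Hypothesis ip_norm : forall x : H, `|x| ^+ 2 = ip x x.

Local Notation Re := complex.Re.

(** The vector representing [phi] minimizes [|v|^2 - 2 Re (phi v)]; by the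
    parallelogram identity minimizing sequences are Cauchy sequences. *)
Lemma riesz (phi : H -> R[i]) (c : R) :
  (forall a x y, phi (a *: x + y) = a * phi x + phi y) ->
  (forall x, rnorm (phi x) <= c * rnorm x) ->
  exists v, forall x, phi x = ip x v.
Proof.
move=> philin phic.
have phiD x y : phi (x + y) = phi x + phi y.
  by have := philin 1 x y; rewrite scale1r mul1r.
have phi0 : phi 0 = 0 by apply: (addrI (phi 0)); rewrite -phiD !addr0.
have phiZ a x : phi (a *: x) = a * phi x.
  by have := philin a x 0; rewrite phi0 !addr0.
pose J v : R := rnorm v ^+ 2 - 2 * Re (phi v).
have J_ge v : - c ^+ 2 <= J v.
  have := le_trans (ler_norm _) (le_trans (ler_rnorm_Re (phi v)) (phic v)).
  by rewrite /J; have := sqr_ge0 (rnorm v - c); rewrite sqrrB; nra.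
pose E := [set J v | v in [set: H]].
have hE : has_inf E.
  by split; [exists (J 0), 0|exists (- c ^+ 2) => _ [v _ <-]].
pose m := inf E.
have mJ v : m <= J v by apply: ge_inf; [exact: hE.2|exists v].
have /choice[v vP] n : exists v, J v < m + n.+1%:R^-1.
  have [|_ [v _ <-] Jv] := inf_adherent (eps := n.+1%:R^-1) _ hE; first by rewrite invr_gt0.
  by exists v.
have Jpar x y :
    rnorm (x - y) ^+ 2 = 2 * J x + 2 * J y - 4 * J (2^-1%:C%C *: (x + y)).
  rewrite /J rnormZ rnorm_real exprMn !(rnormD_sqr ip_norm) ipNr raddfN rnormN.
  rewrite phiZ phiD Re_realM raddfD /= ger0_norm ?invr_ge0 //.
  by field.
have [e e0|w wP] := @rnorm_complete _ _ v.
  have [N NP] := @invSn_lt R (e ^+ 2 / 4) ltac:(by rewrite divr_gt0 ?exprn_gt0).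
  exists N => n Nn; rewrite -(@ltr_pXn2r _ 2) ?nnegrE ?rnorm_ge0 ?(ltW e0) //.
  have key (a b d m' i j s : R) : m' <= d -> a < m' + i -> b < m' + j ->
      i < s / 4 -> j < s / 4 -> 2 * a + 2 * b - 4 * d < s by lra.
  by rewrite Jpar; exact: key (mJ _) (vP n) (vP N) (NP n Nn) (NP N (leqnn N)).
(* Real parts suffice, as the imaginary part of [phi x] is minus the real part of
   [phi ('i *: x)]. *)
suff ReE x : Re (phi x) = Re (ip x w).
  exists w => x; apply/eqP; rewrite eq_complex ReE eqxx /=.
  by have := ReE ('i%C *: x); rewrite phiZ ipZl [_ * phi x]mulrC [_ * ip x w]mulrC !ReiNIm => /oppr_inj->.
(* [J] near its minimum has a small derivative in the direction [x], and this
   derivative is [2 D]. *)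
pose D (y : H) : R := Re (ip x y) - Re (phi x).
have Dt n t : 0 <= t ^+ 2 * rnorm x ^+ 2 + 2 * t * D (v n) + n.+1%:R^-1.
  have key (a p X q s i : R) :
    a - 2 * p <= a + X + 2 * (t * q) - 2 * (p + t * s) + i ->
    0 <= X + 2 * t * (q - s) + i by lra.
  have := le_trans (ltW (vP n)) (lerD (mJ (v n + t%:C%C *: x)) (lexx _)).
  rewrite /J (rnormD_sqr ip_norm) rnormZ rnorm_real phiD phiZ ipZr raddfD /=.
  have -> : Re (t%:C%C^* * ip (v n) x) = t * Re (ip x (v n)).
    by rewrite Re_ipC /= [_^*]conjc_real Re_realM.
  have -> : Re (t%:C%C * phi x) = t * Re (phi x).
    exact: Re_realM.
  rewrite exprMn real_normK ?num_real // /D.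
  exact: key.
have Dlim (e : R) : 0 < e -> exists N, forall n, (N <= n)%N -> `|D (v n) - D w| <= e.
  move=> e0; have x0 : 0 < rnorm x + 1 by rewrite ltr_wpDl ?rnorm_ge0.
  have [N NP] := wP (e / (rnorm x + 1)) (divr_gt0 e0 x0); exists N => n /NP/ltW.
  rewrite ler_pdivlMr // => vw; apply: le_trans vw.
  have -> : D (v n) - D w = Re (ip x (v n - w)).
    by rewrite ipBr raddfB /D /=; ring.
  apply: le_trans (ler_rnorm_Re _) (le_trans (CauchySchwarz ip_norm _ _) _).
  by rewrite mulrC ler_wpM2l ?rnorm_ge0 // lerDl.
have Dw t : 0 <= t ^+ 2 * rnorm x ^+ 2 + 2 * t * D w.
  apply/ler_addgt0Pr => e e0.
  have t0 : 0 < 4 * `|t| + 1 by rewrite ltr_wpDl // mulr_ge0.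
  have [N NP] := Dlim (e / (4 * `|t| + 1)) (divr_gt0 e0 t0).
  have [M MP] := @invSn_lt R (e / 2) ltac:(by rewrite divr_gt0).
  have := NP _ (leq_maxl N M); have := MP _ (leq_maxr N M).
  move: (maxn N M) => n n1 n2.
  have key (X a b i : R) : 0 <= X + 2 * t * a + i -> i < e / 2 ->
    2 * t * (a - b) <= e / 2 -> 0 <= X + 2 * t * b + e by lra.
  apply: key (Dt n t) n1 _.
  apply: le_trans (ler_norm _) _; rewrite !normrM (ger0_norm (ler0n _ 2)).
  apply: le_trans (ler_wpM2l _ n2) _; first by rewrite mulr_ge0.
  have key2 (s q : R) : 0 < q -> 2 * s * q <= q * (4 * s + 1) / 2 by lra.
  rewrite -[X in _ <= X / 2](divfK (lt0r_neq0 t0) e).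
  by apply: key2; rewrite divr_gt0.
apply/eqP; rewrite eq_sym -subr_eq0 -[_ - _]/(D w); apply/eqP.
(* The quadratic inequality [Dw], nearly at its worst [t]; the denominator is
   shifted by [1] to cover [x = 0]. *)
have x0 : 0 < rnorm x ^+ 2 + 1 by rewrite ltr_wpDl ?sqr_ge0.
have := Dw (- D w / (rnorm x ^+ 2 + 1)).
have -> : (- D w / (rnorm x ^+ 2 + 1)) ^+ 2 * rnorm x ^+ 2 +
    2 * (- D w / (rnorm x ^+ 2 + 1)) * D w =
    - (D w ^+ 2 * ((rnorm x ^+ 2 + 2) / (rnorm x ^+ 2 + 1) ^+ 2)).
  by field; rewrite gt_eqF.
rewrite oppr_ge0 pmulr_lle0; last by rewrite divr_gt0 ?exprn_gt0 // ltr_wpDl ?sqr_ge0.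
by move=> D0; apply/eqP; rewrite -sqrf_eq0; apply/eqP/le_anti; rewrite D0 sqr_ge0.
Qed.

(** The Riesz vector of the functional [ip (T x) y] of [x] depends linearly and
    boundedly on [y]; so the default value in the definition of [adjoint] is never
    taken. *)
Lemma adjointP (T : H -> H) : BH T ->
  BH (adjoint ip T) /\ forall x y, ip (T x) y = ip x (adjoint ip T y).
Proof.
move=> BT; rewrite /adjoint; case: xgetP => [S _ //|noS]; exfalso.
have Tlin : linear T := BT.1.
have /choice[S SP] y : exists v, forall x, ip (T x) y = ip x v.
  apply: (@riesz (fun x => ip (T x) y) (opnorm T * rnorm y)) => [a x z|x].
    by rewrite Tlin ipDl ipZl.
  apply: le_trans (CauchySchwarz ip_norm _ _) _.
  by rewrite mulrAC ler_wpM2r ?rnorm_ge0 ?opnorm_ub.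
apply: (noS S); split=> [|x y]; last exact: SP.
apply/BH_bounded; split=> [a x y|].
  by apply: (ip_eq ip_norm) => u; rewrite -SP !(ipDr, ipZr) !SP.
exists (opnorm T) => y; have [->|Sy0] := eqVneq (rnorm (S y)) 0.
  by rewrite mulr_ge0 ?rnorm_ge0 ?opnorm_ge0.
have Sy : 0 < rnorm (S y) by rewrite lt0r Sy0 rnorm_ge0.
rewrite -(ler_pM2r Sy) -expr2 -[_ ^+ 2]ger0_norm ?sqr_ge0 // -rnorm_real.
rewrite -(ip_rnorm ip_norm) -SP; apply: le_trans (CauchySchwarz ip_norm _ _) _.
by rewrite mulrAC ler_wpM2r ?rnorm_ge0 ?opnorm_ub.
Qed.

End Riesz.

Section Star.
Variables (R : realType) (H : completeNormedModType R[i]).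
Variable ip : {dot H for @Num.conj R[i]}.
Hypothesis ip_norm : forall x : H, `|x| ^+ 2 = ip x x.
Local Notation bop := (bop H).
Implicit Types F G : bop.

Definition star F : bop := Bop (adjointP ip_norm (bopP F)).1.

Lemma starP F x y : ip (F x) y = ip x (star F y).
Proof. exact: (adjointP ip_norm (bopP F)).2. Qed.

Lemma star_unique F G : (forall x y, ip (F x) y = ip x (G y)) -> star F = G.
Proof.
by move=> FG; apply: bop_ext => y; apply: (ip_eq ip_norm) => x; rewrite -starP FG.
Qed.

Lemma starK F : star (star F) = F.
Proof. by apply: star_unique => x y; rewrite ipC -starP -ipC. Qed.

Lemma starPr F x y : ip (star F x) y = ip x (F y).
Proof. by rewrite starP starK. Qed.

Lemma starD F G : star (F + G) = star F + star G.
Proof. by apply: star_unique => x y; rewrite !bopDE ipDl ipDr !starP. Qed.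

Lemma starN F : star (- F) = - star F.
Proof. by apply: star_unique => x y; rewrite !bopNE ipNl ipNr !starP. Qed.

Lemma starB F G : star (F - G) = star F - star G.
Proof. by rewrite starD starN. Qed.

Lemma starM F G : star (F * G) = star G * star F.
Proof. by apply: star_unique => x y; rewrite !bopME !starP. Qed.

Lemma starZ a F : star (a *: F) = a^* *: star F.
Proof. by apply: star_unique => x y; rewrite !bopZE ipZl ipZr starP conjCK. Qed.

Lemma star1 : star 1 = 1.
Proof. exact: star_unique. Qed.

Lemma rnorm_star F x : rnorm (F x) ^+ 2 = complex.Re (ip ((star F * F) x) x).
Proof. by rewrite bopME starPr (ip_rnorm ip_norm). Qed.

Lemma starM_ub F x : rnorm (F x) ^+ 2 <= rnorm ((star F * F) x) * rnorm x.
Proof.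
rewrite rnorm_star; apply: le_trans (ler_norm _) _.
exact: le_trans (ler_rnorm_Re _) (CauchySchwarz ip_norm _ _).
Qed.

Lemma nrm_star_le F : nrm (star F) <= nrm F.
Proof.
apply: nrm_le => [|x]; first exact: nrm_ge0.
have [->|Fx] := eqVneq (rnorm (star F x)) 0.
  by rewrite mulr_ge0 ?nrm_ge0 ?rnorm_ge0.
have Fx0 : 0 < rnorm (star F x) by rewrite lt0r Fx rnorm_ge0.
rewrite -(ler_pM2r Fx0) -expr2; apply: le_trans (starM_ub _ _) _.
by rewrite starK bopME mulrAC ler_wpM2r ?rnorm_ge0 ?nrm_ub.
Qed.

End Star.

(** * Joint approximate eigenvectors *)

Section ApproximateKernel.
Variables (R : realType) (H : completeNormedModType R[i]).
Variable ip : {dot H for @Num.conj R[i]}.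
Hypothesis ip_norm : forall x : H, `|x| ^+ 2 = ip x x.
Local Notation bop := (bop H).
Local Notation star := (star ip_norm).
Local Notation Re := complex.Re.
Implicit Types (B E F G N P : bop) (x : H).

(** The operator [E] is not bounded below. Stated of [E - l], this replaces the
    existence of eigenvectors, which may fail. *)
Definition apker E := forall e : R, 0 < e ->
  exists2 x, x != 0 & rnorm (E x) <= e * rnorm x.

Lemma apker_not_binv E : apker E -> ~ binv E.
Proof.
move=> apE [S [SE _]]; have S1 : 0 < 2 * (nrm S + 1).
  by rewrite mulr_gt0 // ltr_wpDl ?nrm_ge0.
have [x /rnorm_gt0 x0 Ex] := apE (2 * (nrm S + 1))^-1 ltac:(by rewrite invr_gt0).
have := nrm_ub S (E x); rewrite -bopME SE bop1E.
move: Ex; rewrite mulrC ler_pdivlMr // => Ex.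
by have := nrm_ge0 S; have := rnorm_ge0 (E x); nra.
Qed.

(** As a quadratic form, [B + c] is at least [1]. *)
Lemma rnorm_shift_ge B (c : R) x : star B = B -> nrm B + 1 <= c ->
  rnorm x <= rnorm ((B + c%:C%C *: (1 : bop)) x).
Proof.
move=> sB Bc; have [->|/rnorm_gt0 x0] := eqVneq x 0; first by rewrite rnorm0 rnorm_ge0.
have := le_trans (ler_norm _) (le_trans (ler_rnorm_Re _) (CauchySchwarz ip_norm
  ((B + c%:C%C *: (1 : bop)) x) x)).
rewrite bopDE bopZE bop1E ipDl ipZl (ip_rnorm ip_norm) raddfD /= mul0r subr0.
have : - (nrm B * rnorm x ^+ 2) <= Re (ip (B x) x).
  rewrite lerNl; apply: le_trans (ler_norm _) _; rewrite normrN.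
  apply: le_trans (ler_rnorm_Re _) (le_trans (CauchySchwarz ip_norm _ _) _).
  by rewrite expr2 mulrA ler_wpM2r ?rnorm_ge0 ?nrm_ub.
move: (rnorm (_ + _)) (Re _) => s r rB rs.
by rewrite -(ler_pM2r x0); nra.
Qed.

Lemma rnorm_selfadj_sqr B (b : R) x : star B = B ->
  rnorm ((B * B - (b ^+ 2)%:C%C *: (1 : bop)) x) ^+ 2 =
  rnorm (B (B x)) ^+ 2 - 2 * b ^+ 2 * rnorm (B x) ^+ 2 + b ^+ 4 * rnorm x ^+ 2.
Proof.
move=> sB; rewrite bopBE bopZE bop1E bopME (rnormD_sqr ip_norm) rnormN ipNr ipZr.
rewrite [_^*]conjc_real raddfN /= Re_realM -{3}sB starPr rnormZ rnorm_real.
by rewrite (ip_rnorm ip_norm) /= exprMn real_normK ?num_real //; ring.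
Qed.

Lemma bop_sub_sqr F (b : R) : F * F - (b ^+ 2)%:C%C *: (1 : bop) =
  (F + b%:C%C *: (1 : bop)) * (F - b%:C%C *: (1 : bop)).
Proof.
rewrite mulrDl !mulrBr -!scale_bopAl -!scale_bopAr !mul1r mulr1.
by rewrite scalerA -rmorphM /= -expr2 addrA subrK.
Qed.

(** Shift [B] to an operator [P] that is bounded below by [1], and let [b] be the
    infimum of the bounds of [P] on near null vectors of [E]. Near null vectors on
    which the bound [b] is nearly attained are approximate null vectors of
    [P ^ 2 - b ^ 2], hence of [P - b]. *)
Lemma apker_selfadj E B : apker E -> star B = B -> GRing.comm E B ->
  exists b : R, forall e : R, 0 < e -> exists2 x, x != 0 &
    rnorm (E x) <= e * rnorm x /\
    rnorm ((B - b%:C%C *: (1 : bop)) x) <= e * rnorm x.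
Proof.
move=> apE sB EB; pose c := nrm B + 1; pose P := B + c%:C%C *: (1 : bop).
have sP : star P = P by rewrite /P starD starZ star1 sB [_^*]conjc_real.
have EP : GRing.comm E P.
  by rewrite /P; apply: commrD => //; rewrite /GRing.comm -scale_bopAl -scale_bopAr mulr1 mul1r.
have P_ge x : rnorm x <= rnorm (P x) by exact: rnorm_shift_ge.
(* [T] is the set of the bounds of [P] valid on all near null vectors of [E]. *)
pose T := [set t : R | exists2 d : R, 0 < d &
  forall y, rnorm (E y) <= d * rnorm y -> rnorm (P y) <= t * rnorm y].
have hT : has_inf T.
  split; first by exists (nrm P), 1 => // y _; exact: nrm_ub.
  exists 1 => t [d d0 tP]; have [x x0 /tP] := apE _ d0.
  by move=> /(le_trans (P_ge x)); rewrite -{1}[rnorm x]mul1r ler_pM2r // rnorm_gt0.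
pose b := inf T.
have b1 : 1 <= b.
  apply: lb_le_inf; first exact: hT.1.
  move=> t [d d0 tP]; have [x x0 /tP] := apE _ d0.
  by move=> /(le_trans (P_ge x)); rewrite -{1}[rnorm x]mul1r ler_pM2r // rnorm_gt0.
exists (b - c) => e e0.
have -> : B - (b - c)%:C%C *: (1 : bop) = P - b%:C%C *: (1 : bop).
  by rewrite /P rmorphB /= scalerBl opprB addrA addrAC.
(* [h * K] bounds [(b + h)^4 - 2 b^2 (b - h)^2 + b^4] for [h <= 1]; it is the square
   of the error made on a unit vector where [P] is within [h] of its bound [b]. *)
pose K := 8 * b ^+ 3 + 4 * b ^+ 2 + 4 * b + 1.
have K0 : 0 < K by rewrite /K; have := exprn_ge0 3 (le_trans ler01 b1); have := sqr_ge0 b; lra.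
pose h := Num.min 1 (e ^+ 2 / K).
have h0 : 0 < h by rewrite lt_min ltr01 divr_gt0 // exprn_gt0.
have h1 : h <= 1 by rewrite ge_min lexx.
have hK : h * K <= e ^+ 2 by rewrite -ler_pdivlMr // ge_min lexx orbT.
have [t [d d0 tP] tb] := inf_adherent h0 hT.
pose d' := Num.min e (d / (nrm P + 1)).
have nP1 : 0 < nrm P + 1 by rewrite ltr_wpDl ?nrm_ge0.
have d'0 : 0 < d' by rewrite lt_min e0 divr_gt0.
have d'e : d' <= e by rewrite ge_min lexx.
have d'P : d' * (nrm P + 1) <= d by rewrite -ler_pdivlMr // ge_min lexx orbT.
have [y Ey Py] : exists2 y, rnorm (E y) <= d' * rnorm y & (b - h) * rnorm y < rnorm (P y).
  apply: contrapT => noy; have Tbh : T (b - h).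
    by exists d' => // y Ey; rewrite leNgt; apply/negP => ?; apply: noy; exists y.
  have := ge_inf hT.2 Tbh; rewrite -/b => bbh.
  by have := le_lt_trans bbh (_ : b - h < b); rewrite ltxx gtrBl => /(_ h0).
have y0 : y != 0.
  by apply: contraTneq Py => ->; rewrite linear0 !rnorm0 mulr0 ltxx.
exists y => //; split; first by rewrite (le_trans Ey) // ler_wpM2r ?rnorm_ge0.
have ny := rnorm_gt0 y0.
(* [P y] is again a near null vector of [E], so that the bound applies to it too. *)
have EPy : rnorm (E (P y)) <= d * rnorm (P y).
  rewrite -bopME EP bopME; apply: le_trans (nrm_ub _ _) _.
  apply: le_trans (ler_wpM2l (nrm_ge0 _) Ey) _.
  have := P_ge y; have := nrm_ge0 P; have := rnorm_ge0 y; nra.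
have PPy := tP _ EPy.
have Pyt : rnorm (P y) <= (b + h) * rnorm y.
  apply: le_trans (tP _ _) _; last by rewrite ler_wpM2r ?rnorm_ge0 // ltW.
  apply: le_trans Ey _; rewrite ler_wpM2r ?rnorm_ge0 //; apply: le_trans d'P.
  by rewrite ler_peMr ?(ltW d'0) // lerDr nrm_ge0.
have PPyt : rnorm (P (P y)) <= (b + h) ^+ 2 * rnorm y.
  apply: le_trans PPy _; rewrite expr2 -mulrA; apply: ler_pM => //.
  - apply: (@le_trans _ _ b); first exact: le_trans ler01 b1.
    by apply: ge_inf; [exact: hT.2|exists d].
  - exact: rnorm_ge0.
  - exact: ltW.
have sq : rnorm ((P * P - (b ^+ 2)%:C%C *: (1 : bop)) y) <= e * rnorm y.
  rewrite -(@ler_pXn2r _ 2) ?nnegrE ?mulr_ge0 ?rnorm_ge0 ?(ltW e0) //.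
  rewrite rnorm_selfadj_sqr // exprMn.
  apply: le_trans (ler_wpM2r (sqr_ge0 _) hK).
  have s2 : rnorm (P (P y)) ^+ 2 <= ((b + h) ^+ 2) ^+ 2 * rnorm y ^+ 2.
    rewrite -exprMn ler_sqr ?nnegrE ?rnorm_ge0 //.
    by rewrite mulr_ge0 ?sqr_ge0 ?rnorm_ge0.
  have p2 : (b - h) ^+ 2 * rnorm y ^+ 2 <= rnorm (P y) ^+ 2.
    rewrite -exprMn ler_sqr ?nnegrE ?rnorm_ge0 ?(ltW Py) //.
    by rewrite mulr_ge0 ?rnorm_ge0 // subr_ge0 (le_trans h1).
  have hb : 8 * b ^+ 3 * h + 4 * b ^+ 2 * h ^+ 2 + 4 * b * h ^+ 3 + h ^+ 4 <= h * K.
    have b0 : 0 <= b by exact: le_trans ler01 b1.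
    have h2 : h ^+ 2 <= h by rewrite expr2 ler_piMl // ltW.
    have h3 : h ^+ 3 <= h by rewrite exprS ler_piMr ?(ltW h0) // exprn_ile1 // ltW.
    have h4 : h ^+ 4 <= h by rewrite exprS ler_piMr ?(ltW h0) // exprn_ile1 // ltW.
    have e2 := ler_wpM2l (mulr_ge0 (ler0n _ 4) (sqr_ge0 b)) h2.
    have e3 := ler_wpM2l (mulr_ge0 (ler0n _ 4) b0) h3.
    rewrite [leRHS](_ : _ = 8 * b ^+ 3 * h + 4 * b ^+ 2 * h + 4 * b * h + h).
      by rewrite !lerD.
    by rewrite /K; ring.
  apply: le_trans (ler_wpM2r (sqr_ge0 (rnorm y)) hb).
  have b2p := ler_wpM2l (mulr_ge0 (ler0n _ 2) (sqr_ge0 b)) p2.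
  apply: le_trans (lerD (lerB s2 b2p) (lexx _)) _.
  by rewrite le_eqVlt; apply/orP; left; apply/eqP; ring.
apply: le_trans sq.
have -> : P * P - (b ^+ 2)%:C%C *: (1 : bop) =
    (B + (c + b)%:C%C *: (1 : bop)) * (P - b%:C%C *: (1 : bop)).
  have -> : B + (c + b)%:C%C *: (1 : bop) = P + b%:C%C *: (1 : bop).
    by rewrite /P rmorphD /= scalerDl addrA.
  exact: bop_sub_sqr.
by apply: rnorm_shift_ge => //; rewrite /c; lra.
Qed.

End ApproximateKernel.

(** * Norms of polynomials in a normal operator *)

Section NormalOperators.
Variables (R : realType) (H : completeNormedModType R[i]).
Variable ip : {dot H for @Num.conj R[i]}.
Hypothesis ip_norm : forall x : H, `|x| ^+ 2 = ip x x.
Local Notation bop := (bop H).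
Local Notation star := (star ip_norm).
Local Notation Re := complex.Re.
Implicit Types (B E F G T : bop) (x : H) (f g : R[i] -> R[i]).

Lemma comm_bop_cst F a : GRing.comm F (a *: (1 : bop)).
Proof. by rewrite /GRing.comm -scale_bopAl -scale_bopAr mul1r mulr1. Qed.

Lemma apker_pair E F :
  (forall e : R, 0 < e -> exists2 x, x != 0 &
     rnorm (E x) <= e * rnorm x /\ rnorm (F x) <= e * rnorm x) ->
  apker (E * E + F * F).
Proof.
move=> EF e e0; pose c := nrm E + nrm F + 1.
have c0 : 0 < c by rewrite ltr_wpDl // addr_ge0 ?nrm_ge0.
have [x x0 [Ex Fx]] := EF (e / c) (divr_gt0 e0 c0); exists x => //.
apply: le_trans (ler_rnormD _ _) _.
have EE := le_trans (nrm_ub E (E x)) (ler_wpM2l (nrm_ge0 E) Ex).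
have FF := le_trans (nrm_ub F (F x)) (ler_wpM2l (nrm_ge0 F) Fx).
apply: le_trans (lerD EE FF) _; rewrite -mulrDl mulrA ler_wpM2r ?rnorm_ge0 //.
by rewrite mulrCA ler_piMr ?(ltW e0) // ler_pdivrMr // mul1r lerDl.
Qed.

(** The quadratic form of [E * E + F * F] is [|E x|^2 + |F x|^2]. *)
Lemma sum_sqr_small E F (e : R) x : star E = E -> star F = F -> 0 <= e ->
  rnorm ((E * E + F * F) x) <= e ^+ 2 * rnorm x ->
  rnorm (E x) <= e * rnorm x /\ rnorm (F x) <= e * rnorm x.
Proof.
move=> sE sF e0 EFx.
have EF2 : rnorm (E x) ^+ 2 + rnorm (F x) ^+ 2 <= (e * rnorm x) ^+ 2.
  have -> : rnorm (E x) ^+ 2 + rnorm (F x) ^+ 2 = Re (ip ((E * E + F * F) x) x).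
    by rewrite !(rnorm_star ip_norm) sE sF bopDE ipDl raddfD.
  apply: le_trans (ler_norm _) (le_trans (ler_rnorm_Re _) _).
  apply: le_trans (CauchySchwarz ip_norm _ _) _.
  by rewrite exprMn [rnorm x ^+ 2]expr2 mulrA ler_wpM2r ?rnorm_ge0.
have ex : 0 <= e * rnorm x by rewrite mulr_ge0 ?rnorm_ge0.
split; rewrite -(@ler_pXn2r _ 2) ?nnegrE ?rnorm_ge0 //; apply: le_trans EF2.
  by rewrite lerDl sqr_ge0.
by rewrite lerDr sqr_ge0.
Qed.

(** Approximate eigenvectors of [N] are joint ones of the commuting self-adjoint
    operators [X] and [Y], twice its real and imaginary parts. They are found one
    after the other by [apker_selfadj], the conditions obtained so far being merged
    into the single operator [E1] by a sum of squares. *)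
Lemma apker_normal N E : GRing.comm N (star N) -> apker E -> star E = E ->
  GRing.comm E N -> exists l : R[i], forall e : R, 0 < e -> exists2 x, x != 0 &
    [/\ rnorm (E x) <= e * rnorm x,
        rnorm ((N - l *: (1 : bop)) x) <= e * rnorm x
      & rnorm ((star N - l^* *: (1 : bop)) x) <= e * rnorm x].
Proof.
move=> NN apE sE EN.
have EsN : GRing.comm E (star N).
  by rewrite /GRing.comm -[in LHS]sE -[in RHS]sE -!starM EN.
pose X := N + star N; pose Y := 'i%C *: (star N - N).
have sX : star X = X by rewrite starD starK addrC.
have sY : star Y = Y.
  rewrite starZ starB starK /Y -opprB scalerN -scaleNr; congr (_ *: _).
  by apply/eqP; rewrite eq_complex /= oppr0 opprK !eqxx.
have EX : GRing.comm E X by exact: commrD.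
have EY : GRing.comm E Y.
  by rewrite /GRing.comm /Y -scale_bopAl -scale_bopAr (commrB EsN EN).
have XY : GRing.comm X Y.
  have XN : GRing.comm X N.
    by apply: commr_sym; apply: commrD; [exact: commr_refl|exact: NN].
  have XsN : GRing.comm X (star N).
    by apply: commr_sym; apply: commrD; [exact: commr_sym|exact: commr_refl].
  by rewrite /GRing.comm /Y -scale_bopAl -scale_bopAr (commrB XsN XN).
have [b1 Xb1] := apker_selfadj apE sX EX.
pose X1 := X - b1%:C%C *: (1 : bop).
have sX1 : star X1 = X1 by rewrite starB starZ star1 sX [_^*]conjc_real.
pose E1 := E * E + X1 * X1.
have E1Y : GRing.comm E1 Y.
  have YE : GRing.comm Y E by exact: commr_sym.
  have YX1 : GRing.comm Y X1.
    by apply: commrB; [exact: commr_sym|exact: comm_bop_cst].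
  by apply: commr_sym; apply: commrD; apply: commrM.
have [b2 Yb2] := apker_selfadj (apker_pair Xb1) sY E1Y.
pose l : R[i] := (2^-1)%:C%C * (b1%:C%C + 'i%C * b2%:C%C).
pose Y1 := Y - b2%:C%C *: (1 : bop).
have NE : N - l *: (1 : bop) = (2^-1)%:C%C *: (X1 + 'i%C *: Y1).
  have -> : 'i%C *: Y1 = N - star N - ('i%C * b2%:C%C) *: (1 : bop).
    by rewrite scalerBr !scalerA -expr2 sqr_i scaleN1r opprB.
  rewrite /X1 /X addrACA -opprD -scalerDl addrACA subrr addr0 scalerBr scalerA -/l.
  rewrite -mulr2n -(scaler_nat 2 N) scalerA -(rmorph_nat (real_complex R)) -rmorphM.
  by rewrite mulVf // scale1r.
have sNE : star N - l^* *: (1 : bop) = (2^-1)%:C%C *: (X1 - 'i%C *: Y1).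
  have sY1 : star Y1 = Y1 by rewrite starB sY starZ star1 [_^*]conjc_real.
  have -> : star N - l^* *: (1 : bop) = star (N - l *: (1 : bop)).
    by rewrite starB starZ star1.
  rewrite NE starZ starD starZ sX1 sY1 [_^*]conjc_real -scaleNr.
  by congr (_ *: (_ + _ *: _)); apply/eqP; rewrite eq_complex /= oppr0 !eqxx.
exists l => e e0; pose e' := Num.min e (e ^+ 2).
have e'0 : 0 < e' by rewrite lt_min e0 exprn_gt0.
have [x x0 [E1x Y1x]] := Yb2 _ e'0; exists x => //.
have {E1x}[Ex X1x] : rnorm (E x) <= e * rnorm x /\ rnorm (X1 x) <= e * rnorm x.
  apply: sum_sqr_small => //; first exact: ltW.
  by apply: le_trans E1x _; rewrite ler_wpM2r ?rnorm_ge0 // ge_min lexx orbT.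
have {}Y1x : rnorm (('i%C *: Y1) x) <= e * rnorm x.
  rewrite bopZE rnormZ [rnorm 'i%C]rnormCE /= expr0n expr1n add0r sqrtr1 mul1r.
  by apply: le_trans Y1x _; rewrite ler_wpM2r ?rnorm_ge0 // ge_min lexx.
split=> //; rewrite ?NE ?sNE bopZE rnormZ rnorm_real ger0_norm ?invr_ge0 //.
  by rewrite ler_pdivrMl //; apply: le_trans (ler_rnormD _ _) _; lra.
by rewrite ler_pdivrMl //; apply: le_trans (ler_rnormB _ _) _; lra.
Qed.

Lemma nrm_attained T (t : R) : 0 <= t -> t < nrm T ->
  exists2 x, x != 0 & t * rnorm x < rnorm (T x).
Proof.
move=> t0 tT; apply: contrapT => noT.
suff : nrm T <= t by rewrite leNgt tT.
apply: nrm_le => // x; have [->|x0] := eqVneq x 0; first by rewrite linear0 !rnorm0 mulr0.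
by rewrite leNgt; apply/negP => xT; apply: noT; exists x.
Qed.

(** Unit vectors on which [T] nearly attains its norm are approximate null vectors. *)
Lemma apker_nrm T : 0 < nrm T ->
  apker (star T * T - (nrm T ^+ 2)%:C%C *: (1 : bop)).
Proof.
move=> T0 e e0; set n := nrm T in T0 *; set S := star T * T.
(* The square of the error is at most [4 n^3 h] on unit vectors [x] with
   [|T x| > n - h]. *)
pose h := Num.min n (e ^+ 2 / (4 * n ^+ 3)).
have n3 : 0 < 4 * n ^+ 3 by rewrite mulr_gt0 ?exprn_gt0.
have h0 : 0 < h by rewrite lt_min T0 divr_gt0 // exprn_gt0.
have hn : h <= n by rewrite ge_min lexx.
have he : h * (4 * n ^+ 3) <= e ^+ 2 by rewrite -ler_pdivlMr // ge_min lexx orbT.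
have nh0 : 0 <= n - h by rewrite subr_ge0.
have nhn : n - h < nrm T by rewrite -/n gtrBl.
have [x x0 Tx] := nrm_attained nh0 nhn.
exists x => //; rewrite -(@ler_pXn2r _ 2) ?nnegrE ?mulr_ge0 ?rnorm_ge0 ?(ltW e0) //.
have key : rnorm ((S - (n ^+ 2)%:C%C *: (1 : bop)) x) ^+ 2 =
    rnorm (S x) ^+ 2 - 2 * n ^+ 2 * rnorm (T x) ^+ 2 + n ^+ 4 * rnorm x ^+ 2.
  rewrite bopBE bopZE bop1E (rnormD_sqr ip_norm) rnormN rnormZ rnorm_real ipNr ipZr.
  rewrite [_^*]conjc_real raddfN /= Re_realM (starPr ip_norm T) (ip_rnorm ip_norm) /=.
  by rewrite exprMn real_normK ?num_real //; ring.
have Sx : rnorm (S x) ^+ 2 <= n ^+ 4 * rnorm x ^+ 2.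
  have -> : n ^+ 4 * rnorm x ^+ 2 = (n * (n * rnorm x)) ^+ 2 by ring.
  rewrite ler_sqr ?nnegrE ?rnorm_ge0 ?mulr_ge0 ?rnorm_ge0 ?(ltW T0) //.
  apply: le_trans (nrm_ub (star T) (T x)) _.
  apply: ler_pM; rewrite ?nrm_ge0 ?rnorm_ge0 //.
    exact: nrm_star_le.
  exact: nrm_ub.
have T2 : (n - h) ^+ 2 * rnorm x ^+ 2 <= rnorm (T x) ^+ 2.
  rewrite -exprMn ler_sqr ?nnegrE ?rnorm_ge0 ?(ltW Tx) //.
  by rewrite mulr_ge0 ?rnorm_ge0 // subr_ge0.
rewrite key exprMn.
have T2n := ler_wpM2l (mulr_ge0 (ler0n _ 2) (sqr_ge0 n)) T2.
apply: le_trans (lerD (lerB Sx T2n) (lexx _)) _.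
apply: le_trans (ler_wpM2r (sqr_ge0 _) he).
rewrite -subr_ge0 [X in 0 <= X](_ : _ = 2 * ((n * h) ^+ 2 * rnorm x ^+ 2)); last by ring.
by apply: mulr_ge0 => //; apply: mulr_ge0; exact: sqr_ge0.
Qed.

(** Polynomials in [N] and its adjoint are related to polynomial functions of [z] and
    its conjugate without passing through coefficients. That [F] depends only on the
    function [f] is a consequence of the norm estimate [starpoly_nrm_le]. *)
Inductive starpoly (N : bop) : (R[i] -> R[i]) -> bop -> Prop :=
| starpoly_cst a : starpoly N (fun=> a) (a *: (1 : bop))
| starpoly_id : starpoly N id N
| starpoly_conj : starpoly N (fun z => z^*) (star N)
| starpolyD f g F G : starpoly N f F -> starpoly N g G ->
    starpoly N (fun z => f z + g z) (F + G)
| starpolyM f g F G : starpoly N f F -> starpoly N g G ->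
    starpoly N (fun z => f z * g z) (F * G).

Lemma starpolyZ N a f F : starpoly N f F -> starpoly N (fun z => a * f z) (a *: F).
Proof.
move=> pF; have := starpolyM (starpoly_cst N a) pF.
by rewrite -scale_bopAl mul1r.
Qed.

Lemma starpolyB N f g F G : starpoly N f F -> starpoly N g G ->
  starpoly N (fun z => f z - g z) (F - G).
Proof.
move=> pF pG; have := starpolyD pF (starpolyZ (-1) pG).
by rewrite scaleN1r; under eq_fun do rewrite mulN1r.
Qed.

Lemma starpolyX N f F n : starpoly N f F -> starpoly N (fun z => f z ^+ n) (F ^+ n).
Proof.
move=> pF; elim: n => [|n IH].
  by have := starpoly_cst N 1; rewrite scale1r.
by under eq_fun do rewrite exprS; rewrite exprS; exact: starpolyM.
Qed.

Lemma starpoly_sum N (I : Type) (r : seq I) (f : I -> R[i] -> R[i]) (F : I -> bop) :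
  (forall i, starpoly N (f i) (F i)) ->
  starpoly N (fun z => \sum_(i <- r) f i z) (\sum_(i <- r) F i).
Proof.
move=> pF; elim: r => [|i r IH].
  have := starpoly_cst N 0; rewrite scale0r big_nil.
  by under [in X in _ -> X]eq_fun do rewrite big_nil.
by rewrite big_cons; under eq_fun do rewrite big_cons; exact: starpolyD.
Qed.

Lemma starpoly_comm N f F B : GRing.comm B N -> GRing.comm B (star N) ->
  starpoly N f F -> GRing.comm B F.
Proof.
move=> BN BsN; elim=> // [a|f1 g1 F1 G1 _ BF1 _ BG1|f1 g1 F1 G1 _ BF1 _ BG1].
- exact: comm_bop_cst.
- exact: commrD.
- exact: commrM.
Qed.

Variable N : bop.
Hypothesis NN : GRing.comm N (star N).

Lemma starpoly_comm2 f g F G : starpoly N f F -> starpoly N g G -> GRing.comm F G.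
Proof.
move=> pF; apply: starpoly_comm; apply: commr_sym.
  by apply: starpoly_comm pF => //; exact: commr_refl.
by apply: starpoly_comm pF => //; exact: commr_sym.
Qed.

Lemma starpoly_star f F : starpoly N f F -> starpoly N (fun z => (f z)^*) (star F).
Proof.
elim=> [a|||f1 g1 F1 G1 pF1 IF1 pG1 IG1|f1 g1 F1 G1 pF1 IF1 pG1 IG1].
- by rewrite starZ star1; exact: starpoly_cst.
- exact: starpoly_conj.
- by rewrite starK; under eq_fun do rewrite conjCK; exact: starpoly_id.
- by rewrite starD; under eq_fun do rewrite rmorphD; exact: starpolyD.
- rewrite starM (starpoly_comm2 IG1 IF1); under eq_fun do rewrite rmorphM.
  exact: starpolyM.
Qed.

(** Approximate joint eigenvectors of [N] and its adjoint are approximate eigenvectors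
    of all polynomials in them, with an error that is linear in the initial one. *)
Lemma starpoly_eigen f F l : starpoly N f F -> exists2 C : R, 0 <= C &
  forall x (e : R), 0 <= e -> rnorm ((N - l *: (1 : bop)) x) <= e ->
    rnorm ((star N - l^* *: (1 : bop)) x) <= e ->
    rnorm ((F - f l *: (1 : bop)) x) <= C * e.
Proof.
elim=> [a|||f1 g1 F1 G1 _ [C C0 FC] _ [D D0 GD]|f1 g1 F1 G1 _ [C C0 FC] _ [D D0 GD]].
- by exists 0 => // x e _ _ _; rewrite subrr bop0E rnorm0 mul0r.
- by exists 1 => // x e e0 + _; rewrite mul1r.
- by exists 1 => // x e e0 _; rewrite mul1r.
- exists (C + D); first exact: addr_ge0.
  move=> x e e0 Nx sNx; rewrite scalerDl opprD addrACA mulrDl.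
  by apply: le_trans (ler_rnormD _ _) (lerD _ _); [exact: FC|exact: GD].
exists (nrm F1 * D + rnorm (g1 l) * C).
  by rewrite addr_ge0 ?mulr_ge0 ?nrm_ge0 ?rnorm_ge0.
move=> x e e0 Nx sNx.
have -> : F1 * G1 - (f1 l * g1 l) *: (1 : bop) =
    F1 * (G1 - g1 l *: (1 : bop)) + g1 l *: (F1 - f1 l *: (1 : bop)).
  rewrite mulrBr -scale_bopAr mulr1 scalerBr scalerA [g1 l * _]mulrC.
  by rewrite addrA subrK.
rewrite mulrDl -!mulrA; apply: le_trans (ler_rnormD _ _) (lerD _ _).
  by apply: le_trans (nrm_ub F1 _) (ler_wpM2l (nrm_ge0 _) _); exact: GD.
by rewrite bopZE rnormZ; apply: (ler_wpM2l (rnorm_ge0 _)); exact: FC.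
Qed.

(** An approximate eigenvector of [star F * F] for [nrm F ^ 2] may be taken to be
    an approximate eigenvector of [N] as well. *)
Lemma starpoly_nrm_attained f F : 0 < nrm F -> starpoly N f F ->
  exists2 l, spectrum N l & nrm F = rnorm (f l).
Proof.
move=> F0 pF; pose E := star F * F - (nrm F ^+ 2)%:C%C *: (1 : bop).
have pE : starpoly N (fun z => (f z)^* * f z - (nrm F ^+ 2)%:C%C) E.
  by apply: starpolyB (starpoly_cst _ _); apply: starpolyM => //; exact: starpoly_star.
have sE : star E = E.
  by rewrite starB starM starK starZ star1 [_^*]conjc_real.
have EN := starpoly_comm2 pE (starpoly_id N).
have [l lP] := apker_normal NN (apker_nrm F0) sE EN.
exists l.
  apply/spectrumP; apply: apker_not_binv => e /lP[x x0 [_ Nx _]].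
  by exists x.
have [C C0 EC] := starpoly_eigen l pE.
set a := (f l)^* * f l - (nrm F ^+ 2)%:C%C in EC.
suff a0 : rnorm a <= 0.
  have /eqP : a = 0 by apply/rnorm_eq0/le_anti; rewrite a0 rnorm_ge0.
  rewrite subr_eq0 mulrC -normCK rnormE -rmorphXn /= => /eqP/complexI/eqP.
  by rewrite eqrXn2 ?rnorm_ge0 ?nrm_ge0 // => /eqP.
apply/ler_addgt0Pr => e e0; rewrite add0r.
have C1 : 0 < C + 1 by rewrite ltr_wpDl.
have [x x0 [Ex Nx sNx]] := lP (e / (C + 1)) (divr_gt0 e0 C1).
have nx := rnorm_gt0 x0.
rewrite -(ler_pM2r nx) -rnormZ.
have -> : a *: x = E x - (E - a *: (1 : bop)) x by rewrite bopBE opprB addrC subrK.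
apply: le_trans (ler_rnormB _ _) _.
have ex : 0 <= e / (C + 1) * rnorm x by rewrite mulr_ge0 ?rnorm_ge0 // divr_ge0 ?(ltW e0) ?(ltW C1).
apply: le_trans (lerD Ex (EC _ _ ex Nx sNx)) _.
rewrite -[X in X + _]mul1r -mulrDl mulrA ler_wpM2r ?rnorm_ge0 // addrC.
by rewrite mulrC divfK ?gt_eqF.
Qed.

Lemma starpoly_nrm_le f F (c : R) : 0 <= c -> starpoly N f F ->
  (forall z, spectrum N z -> rnorm (f z) <= c) -> nrm F <= c.
Proof.
move=> c0 pF fc; have [F0|] := leP (nrm F) 0; first exact: le_trans F0 c0.
by move=> /starpoly_nrm_attained-/(_ _ pF)[l /fc fl ->].
Qed.

(** The norm of the constant polynomial [1] is attained too. *)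
Lemma normal_spectrum_neq0 : (exists x : H, x != 0) -> exists l, spectrum N l.
Proof.
move=> [x x0]; have N1 : 0 < nrm (1 : bop).
  rewrite ltNge; apply/negP => /nrm_eq0/(congr1 (fun F : bop => F x)) /eqP.
  exact/negP.
have := starpoly_cst N 1; rewrite scale1r.
by move=> /(starpoly_nrm_attained N1)[l Nl _]; exists l.
Qed.

End NormalOperators.

(** * Fuglede's theorem *)

Section CauchyEstimate.
Variables (R : realType) (H : completeNormedModType R[i]).
Local Notation bop := (bop H).

Lemma prim_root_exists n : (0 < n)%N -> exists z : R[i], n.-primitive_root z.
Proof.
move=> n0; pose p : {poly R[i]} := 'X^n - 1.
have [r rE] := closed_field_poly_normal p.
have pm : p \is monic by exact: monicXnsubC.
rewrite (monicP pm) scale1r in rE.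
have rn z : z \in r -> n.-unity_root z by rewrite -root_prod_XsubC -rE.
have ru : uniq r.
  rewrite -separable.separable_prod_XsubC -rE; apply: cyclotomic.separable_Xn_sub_1.
  by rewrite pnatr_eq0 -lt0n.
have sr : (n <= size r)%N.
  by rewrite -ltnS -(size_prod_XsubC r id) -rE size_XnsubC.
have /hasP[z zr pz] : has n.-primitive_root r.
  by apply: cyclic.has_prim_root => //; apply/allP.
by exists z.
Qed.

Lemma sum_unity_root n (z : R[i]) : z ^+ n = 1 -> z != 1 -> \sum_(k < n) z ^+ k = 0.
Proof.
move=> zn z1; have := subrX1 z n; rewrite zn subrr => /esym/eqP.
by rewrite mulf_eq0 subr_eq0 (negPf z1) => /eqP.
Qed.

(** The average of [l^(- 1) P(l)] over the circle of radius [r], taken over [n]-th roots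
    of unity, isolates the coefficient of degree [1] if [P] has degree less than [n]. *)
Lemma cauchy_estimate n (C : nat -> bop) (r c : R) : (1 < n)%N -> 0 < r ->
  (forall l : R[i], rnorm l = r -> nrm (\sum_(j < n) l ^+ j *: C j) <= c) ->
  r * nrm (C 1) <= c.
Proof.
move=> n1 r0 Pc; have n0 : (0 < n)%N by exact: ltnW.
have [w pw] := prim_root_exists n0; have wn := prim_expr_order pw.
have rw : rnorm w = 1.
  by apply/eqP; rewrite -(@pexpr_eq1 _ _ n) ?rnorm_ge0 // -rnormX wn rnorm1.
(* The inverse of [w ^+ k] is written [(w ^+ k) ^+ n.-1]. *)
have avg : \sum_(k < n) (w ^+ k) ^+ n.-1 *:
    (\sum_(j < n) (r%:C%C * w ^+ k) ^+ j *: C j) = (n%:R * r%:C%C) *: C 1.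
  under eq_bigr do rewrite scaler_sumr.
  rewrite exchange_big /=.
  transitivity (\sum_(j < n) (r%:C%C ^+ j * \sum_(k < n) (w ^+ (n.-1 + j)) ^+ k) *: C j).
    apply: eq_bigr => j _; rewrite mulr_sumr scaler_suml; apply: eq_bigr => k _.
    rewrite scalerA; congr (_ *: _).
    by rewrite exprMn -!exprM mulrCA -exprD -mulnDr mulnC.
  rewrite (bigD1 (Ordinal n1)) //= [X in _ + X]big1 => [|j j1].
    rewrite addr0 expr1 addn1 prednK // wn.
    by under eq_bigr do rewrite expr1n; rewrite sumr_const card_ord mulrC.
  rewrite sum_unity_root ?mulr0 ?scale0r //.
    by rewrite -exprM mulnC exprM wn expr1n.
  rewrite -(prim_order_dvd pw); apply: contra j1 => /dvdnP[q qE].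
  apply/eqP/val_inj => /=; move: (ltn_ord j) qE; move: (j : nat) => k.
  by case: q => [|[|q]]; rewrite ?mulSn ?mul0n; lia.
have nr : nrm ((n%:R * r%:C%C) *: C 1) <= n%:R * c.
  rewrite -avg; apply: le_trans (ler_nrm_sum _ _ _) _.
  rewrite -[n in n%:R]card_ord mulr_natl -sumr_const; apply: ler_sum => k _.
  apply: le_trans (ler_nrmZ _ _) _; rewrite !rnormX rw !expr1n mul1r; apply: Pc.
  by rewrite rnormM rnormX rw expr1n mulr1 rnorm_real gtr0_norm.
have n0R : 0 < n%:R :> R by rewrite ltr0n.
have nrC : rnorm (n%:R * r%:C%C : R[i]) = n%:R * r.
  by rewrite rnormM rnorm_nat rnorm_real gtr0_norm.
have nr0 : n%:R * r%:C%C != 0 :> R[i].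
  by apply/eqP => nr0; move: nrC; rewrite nr0 rnorm0 => /esym/eqP; rewrite mulf_eq0 !gt_eqF.
have : nrm (C 1) <= (n%:R * r)^-1 * (n%:R * c).
  rewrite -[C 1]scale1r -(mulVf nr0) -scalerA; apply: le_trans (ler_nrmZ _ _) _.
  by rewrite rnormV nrC ler_wpM2l ?invr_ge0 ?mulr_ge0 ?ler0n ?(ltW r0).
by rewrite ler_pdivlMl ?mulr_gt0 // -mulrA ler_pM2l.
Qed.

(** Only the coefficient of degree [1] matters later; the one of degree [0] is there
    for the induction. *)
Lemma exp_sandwich (A X : bop) m1 m2 : exists n (C : nat -> bop),
  [/\ (1 < n)%N, C 0%N = A, C 1%N = m1%:R *: (X * A) - m2%:R *: (A * X) &
      forall l : R[i], (1 + l *: X) ^+ m1 * A * (1 - l *: X) ^+ m2 =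
        \sum_(j < n) l ^+ j *: C j].
Proof.
(* The induction needs the coefficients to vanish from [n] on. *)
have : exists n (C : nat -> bop), [/\ (1 < n)%N, C 0%N = A,
    C 1%N = m1%:R *: (X * A) - m2%:R *: (A * X), forall j, (n <= j)%N -> C j = 0 &
    forall l : R[i], (1 + l *: X) ^+ m1 * A * (1 - l *: X) ^+ m2 =
        \sum_(j < n) l ^+ j *: C j]; last first.
  by move=> [n [C [n1 C0 C1 _ CE]]]; exists n, C.
elim: m2 => [|m2 [n [C [n1 C0 C1 Cn CE]]]].
  elim: m1 => [|m1 [n [C [n1 C0 C1 Cn CE]]]].
    exists 2, (fun j => if j is 0%N then A else 0).
    split=> //; first by rewrite !scale0r subrr.
      by case.
    by move=> l; rewrite !expr0 mul1r mulr1 big_ord_recl big_ord1 scale1r scaler0 addr0.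
  exists n.+1, (fun j => if j is j'.+1 then C j + X * C j' else C 0%N).
  split=> //.
  - exact: ltnW.
  - by rewrite C0 C1 -[m1.+1]addn1 natrD scalerDl scale1r !scale0r !subr0.
  - case=> // j nj; rewrite !Cn ?mulr0 ?addr0 //; exact: ltnW.
  - move=> l; rewrite exprS -!mulrA [X in (1 + _) * X]mulrA CE mulrDl mul1r.
    rewrite big_ord_recl /=; under [in RHS]eq_bigr do rewrite scalerDr.
    rewrite big_split /= addrA.
    have -> : l ^+ 0 *: C 0%N + \sum_(i < n) l ^+ (bump 0 i) *: C i.+1 =
        \sum_(j < n) l ^+ j *: C j.
      have := big_ord_recl n (fun j : 'I_n.+1 => l ^+ j *: C j) => /= <-.
      by rewrite big_ord_recr /= Cn // scaler0 addr0.
    congr (_ + _); rewrite mulr_sumr; apply: eq_bigr => j _.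
    by rewrite -scale_bopAr -!scale_bopAl scalerA -exprSr.
exists n.+1, (fun j => if j is j'.+1 then C j - C j' * X else C 0%N).
split=> //.
- exact: ltnW.
- by rewrite C0 C1 -[m2.+1]addn1 natrD scalerDl scale1r opprD addrA.
- case=> // j nj; rewrite !Cn ?mul0r ?subr0 //; exact: ltnW.
- move=> l; rewrite exprSr mulrA CE mulrBr mulr1.
  rewrite big_ord_recl /=; under [in RHS]eq_bigr do rewrite scalerBr.
  rewrite sumrB /= addrA.
  have -> : l ^+ 0 *: C 0%N + \sum_(i < n) l ^+ (bump 0 i) *: C i.+1 =
      \sum_(j < n) l ^+ j *: C j.
    have := big_ord_recl n (fun j : 'I_n.+1 => l ^+ j *: C j) => /= <-.
    by rewrite big_ord_recr /= Cn // scaler0 addr0.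
  congr (_ - _); rewrite mulr_suml; apply: eq_bigr => j _.
  by rewrite -scale_bopAr -!scale_bopAl scalerA -exprS.
Qed.

End CauchyEstimate.

Section PowerEstimates.
Variable R : realType.
Implicit Types (t : R) (v : R[i]).

Lemma ler_powr (x y : R) k : 0 <= x -> x <= y -> x ^+ k <= y ^+ k.
Proof. by move=> x0 xy; rewrite lerXn2r ?nnegrE // (le_trans x0). Qed.

Lemma expr1D_le t m : 0 <= t -> m%:R * t <= 2^-1 -> (1 + t) ^+ m <= 1 + 2 * (m%:R * t).
Proof.
move=> t0; elim: m => [|m IH]; first by rewrite mul0r mulr0 addr0.
rewrite -natr1 mulrDl mul1r => mt; have mt' : m%:R * t <= 2^-1 by lra.
rewrite exprSr; apply: le_trans (ler_wpM2r _ (IH mt')) _; first by rewrite addr_ge0.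
have m0 : 0 <= m%:R * t by rewrite mulr_ge0.
move: (m%:R * t) m0 mt mt' => s s0 _ s1; nra.
Qed.

Lemma rnorm_expr1B_sub1 v m : rnorm ((1 - v) ^+ m - 1) <= (1 + rnorm v) ^+ m - 1.
Proof.
elim: m => [|m IH]; first by rewrite !expr0 !subrr rnorm0.
have -> : (1 - v) ^+ m.+1 - 1 = ((1 - v) ^+ m - 1) * (1 - v) - v by rewrite exprSr; ring.
have -> : (1 + rnorm v) ^+ m.+1 - 1 = ((1 + rnorm v) ^+ m - 1) * (1 + rnorm v) + rnorm v.
  by rewrite exprSr; ring.
apply: le_trans (ler_rnormB _ _) _; rewrite lerD2r rnormM.
apply: ler_pM => //; rewrite ?rnorm_ge0 //.
by rewrite -[in leRHS](rnorm1 R) ler_rnormB.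
Qed.

Lemma expr1D_le_expR t m : 0 <= t -> (1 + t / m.+1%:R) ^+ m.+1 <= expR t.
Proof.
move=> t0; have tm : 0 <= t / m.+1%:R by rewrite divr_ge0.
have := @expR_ge1Dx R (t / m.+1%:R).
rewrite -(@ler_pXn2r _ m.+1) ?nnegrE ?addr_ge0 ?expR_ge0 // => /le_trans; apply.
by rewrite -expRM_natl -mulr_natl mulrC divfK ?pnatr_eq0.
Qed.

End PowerEstimates.

Section Fuglede.
Variables (R : realType) (H : completeNormedModType R[i]).
Variable ip : {dot H for @Num.conj R[i]}.
Hypothesis ip_norm : forall x : H, `|x| ^+ 2 = ip x x.
Local Notation bop := (bop H).
Local Notation star := (star ip_norm).
Variables N A : bop.
Hypotheses (NN : GRing.comm N (star N)) (AN : GRing.comm A N).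

Lemma starpoly_affine a m : starpoly ip_norm N (fun z => (1 + a * z) ^+ m) ((1 + a *: N) ^+ m).
Proof.
apply: (starpolyX (f := fun z => 1 + a * z)).
have := starpolyD (starpoly_cst ip_norm N 1) (starpolyZ a (starpoly_id ip_norm N)).
by rewrite scale1r.
Qed.

Lemma starpoly_conj_affine a m :
  starpoly ip_norm N (fun z => (1 + a * z^*) ^+ m) ((1 + a *: star N) ^+ m).
Proof.
apply: (starpolyX (f := fun z => 1 + a * z^*)).
have := starpolyD (starpoly_cst ip_norm N 1) (starpolyZ a (starpoly_conj ip_norm N)).
by rewrite scale1r.
Qed.

(** With [S] the adjoint of [N], and since [A] commutes with [N],
    [exp (l S) A exp (- l S) = exp (l S - l^* N) A exp (l^* N - l S)], where the
    outer factors of the right-hand side are values at [N] of functions of modulus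
    [1]; so the left-hand side is bounded in [l]. To stay within polynomials,
    [(1 + u / m) ^ m] replaces [exp u]. *)
Lemma fuglede_bound (r e : R) m : 0 < r ->
  let s := r * nrm N in
  m.+1%:R * (s / m.+1%:R) ^+ 2 <= 2^-1 ->
  e = 2 * (m.+1%:R * (s / m.+1%:R) ^+ 2) ->
  forall l : R[i], rnorm l = r ->
  nrm ((1 + l *: (m.+1%:R^-1 *: star N)) ^+ m.+1 * A *
       (1 - l *: (m.+1%:R^-1 *: star N)) ^+ m.+1)
  <= (1 + e) * nrm A * (1 + e) + expR s * nrm A * e * expR s.
Proof.
move=> r0 s smalls eE l lr; set k := m.+1 in smalls eE *.
have k0 : 0 < k%:R :> R by rewrite ltr0n.
have s0 : 0 <= s by rewrite mulr_ge0 ?nrm_ge0 ?(ltW r0).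
have sk0 : 0 <= s / k%:R by rewrite divr_ge0 // ltW.
have e0 : 0 <= e.
  by rewrite eE; apply: mulr_ge0 => //; apply: mulr_ge0 => //; exact: sqr_ge0.
(* [u] is the function denoted [u / m] above, with [k] for [m]. *)
pose a := l / k%:R; have ra : rnorm a = r / k%:R by rewrite rnormM rnormV rnorm_nat lr.
rewrite scalerA -/a -scaleNr.
pose u z := a * z^*.
have uE z : (u z)^* = a^* * z by rewrite /u rmorphM /= conjCK.
have ru z : spectrum N z -> rnorm (u z) <= s / k%:R.
  move=> /spectrum_le zN; rewrite rnormM rnorm_conj ra mulrAC.
  by rewrite ler_wpM2r ?invr_ge0 ?(ltW k0) // ler_wpM2l ?(ltW r0).
have u_exp z : spectrum N z -> (1 + rnorm (u z)) ^+ k <= expR s.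
  move=> /ru uz; apply: le_trans (expr1D_le_expR m s0).
  by apply: ler_powr; rewrite ?addr_ge0 ?rnorm_ge0 // lerD2l.
have u_sq z : spectrum N z -> (1 + rnorm (u z) ^+ 2) ^+ k <= 1 + e.
  move=> /ru uz; apply: le_trans (_ : (1 + (s / k%:R) ^+ 2) ^+ k <= _).
    apply: ler_powr; first by rewrite addr_ge0 ?sqr_ge0.
    by rewrite lerD2l; apply: ler_powr; rewrite ?rnorm_ge0.
  by rewrite eE; apply: expr1D_le => //; exact: sqr_ge0.
have u_prod z : spectrum N z -> rnorm ((1 - u z ^+ 2) ^+ k) <= 1 + e.
  move=> /u_sq; apply: le_trans; rewrite rnormX; apply: ler_powr; first exact: rnorm_ge0.
  by rewrite -rnormX -[X in _ <= X + _](rnorm1 R) ler_rnormB.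
set qp := (1 + a *: star N) ^+ k; set qm := (1 + (- a) *: star N) ^+ k.
pose sp := (1 + a^* *: N) ^+ k; pose sm := (1 + (- a^*) *: N) ^+ k.
have pqp : starpoly ip_norm N (fun z => (1 + u z) ^+ k) qp by exact: starpoly_conj_affine.
have pqm : starpoly ip_norm N (fun z => (1 - u z) ^+ k) qm.
  by have := starpoly_conj_affine (- a) k; under eq_fun do rewrite mulNr.
have psp : starpoly ip_norm N (fun z => (1 + (u z)^*) ^+ k) sp.
  by under eq_fun do rewrite uE; exact: starpoly_affine.
have psm : starpoly ip_norm N (fun z => (1 - (u z)^*) ^+ k) sm.
  by under eq_fun do rewrite uE -mulNr; exact: starpoly_affine.
have nqp : nrm qp <= expR s.
  apply: (starpoly_nrm_le NN (expR_ge0 s) pqp) => z /u_exp; apply: le_trans.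
  rewrite rnormX; apply: ler_powr; first exact: rnorm_ge0.
  by rewrite -[X in _ <= X + _](rnorm1 R) ler_rnormD.
have nqm : nrm qm <= expR s.
  apply: (starpoly_nrm_le NN (expR_ge0 s) pqm) => z /u_exp; apply: le_trans.
  rewrite rnormX; apply: ler_powr; first exact: rnorm_ge0.
  by rewrite -[X in _ <= X + _](rnorm1 R) ler_rnormB.
have e10 : 0 <= 1 + e by rewrite addr_ge0.
have nqs : nrm (qp * sm) <= 1 + e.
  apply: (starpoly_nrm_le NN e10 (starpolyM pqp psm)) => z /u_prod; apply: le_trans.
  rewrite rnormM -[X in X * _]rnorm_conj -rnormM rmorphXn /= -exprMn.
  by rewrite -[in leRHS]rnorm_conj rmorphXn rmorphB rmorphXn rmorphD rmorph1 /= mulrC -subr_sqr expr1n.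
have nsq : nrm (sp * qm) <= 1 + e.
  apply: (starpoly_nrm_le NN e10 (starpolyM psp pqm)) => z /u_prod; apply: le_trans.
  rewrite rnormM -[X in X * _]rnorm_conj -rnormM rmorphXn rmorphD rmorph1 /=.
  rewrite (_ : ((u z)^*)^* = u z) -?exprMn; last exact: conjCK.
  by rewrite mulrC -subr_sqr expr1n.
have n1s : nrm (1 - sm * sp) <= e.
  have p1 : starpoly ip_norm N (fun=> 1) 1 by have := starpoly_cst ip_norm N 1; rewrite scale1r.
  apply: (starpoly_nrm_le NN e0 (starpolyB p1 (starpolyM psm psp))) => z Nz.
  rewrite -exprMn -subr_sqr expr1n rdistC; apply: le_trans (rnorm_expr1B_sub1 _ _) _.
  by rewrite rnormX rnorm_conj lerBlDl u_sq.
have Asm : GRing.comm A sm.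
  apply: commrX; apply: commrD; first exact: commr1.
  by rewrite /GRing.comm -scale_bopAl -scale_bopAr AN.
(* Insert [sm * sp], which is nearly [1], and move [sm] across [A]. *)
have -> : qp * A * qm = (qp * sm) * A * (sp * qm) + qp * A * (1 - sm * sp) * qm.
  rewrite mulrBr mulr1 mulrBl -!mulrA [sm * (A * _)]mulrA -Asm -!mulrA.
  by rewrite addrC subrK.
apply: le_trans (ler_nrmD _ _) (lerD _ _); do 3?apply: ler_nrmMM => //.
Qed.

(** The commutator of [A] and [star N] is the derivative at [0] of the family of
    [fuglede_bound], so that [cauchy_estimate] on large circles makes it vanish. *)
Theorem fuglede : GRing.comm A (star N).
Proof.
pose D := star N * A - A * star N; pose B := 4 * nrm A + 1.
have B0 : 0 < B by rewrite ltr_wpDl // mulr_ge0 ?nrm_ge0.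
suff D0 : D = 0 by apply/esym/eqP; rewrite -subr_eq0; apply/eqP.
apply: nrm_small => d d0; pose r := B / d.
have r0 : 0 < r by rewrite divr_gt0.
suff : r * nrm D <= B.
  by rewrite /r mulrAC ler_pdivrMr // ler_pM2l.
pose s := r * nrm N; have s0 : 0 <= s by rewrite mulr_ge0 ?nrm_ge0 ?(ltW r0).
pose K := expR s * nrm A * expR s + 1.
have K0 : 0 < K by rewrite ltr_wpDl // !mulr_ge0 ?nrm_ge0 ?expR_ge0.
have K1 : 1 <= K by rewrite lerDr !mulr_ge0 ?nrm_ge0 ?expR_ge0.
(* This [m] makes the relative error [e] of [(1 + u / m) ^ m] at most [1 / K]. *)
pose m := Num.truncn (2 * s ^+ 2 * K).
have mK : 2 * s ^+ 2 * K < m.+1%:R by exact: truncnS_gt.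
have m0 : 0 < m.+1%:R :> R by rewrite ltr0n.
have sm : m.+1%:R * (s / m.+1%:R) ^+ 2 = s ^+ 2 / m.+1%:R.
  by move: m.+1%:R m0 => x x0; field; rewrite gt_eqF.
pose e := 2 * (m.+1%:R * (s / m.+1%:R) ^+ 2).
have e0 : 0 <= e.
  by rewrite /e; apply: mulr_ge0 => //; apply: mulr_ge0 => //; exact: sqr_ge0.
have eK : e * K <= 1.
  by rewrite /e sm mulrA mulrAC ler_pdivrMr // mul1r ltW.
have e1 : e <= 1 by apply: le_trans eK; rewrite ler_peMr.
have [n [C [n1 C0 C1 CE]]] := exp_sandwich A (m.+1%:R^-1 *: star N) m.+1 m.+1.
have -> : D = C 1%N.
  have m0C : m.+1%:R != 0 :> R[i] by rewrite pnatr_eq0.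
  by rewrite C1 -scale_bopAl -scale_bopAr !scalerA mulfV // !scale1r.
apply: (cauchy_estimate n1 r0) => l lr; rewrite -CE.
have esm : m.+1%:R * (s / m.+1%:R) ^+ 2 <= 2^-1.
  have : 2 * (m.+1%:R * (s / m.+1%:R) ^+ 2) <= 1 by exact: e1.
  by move: (m.+1%:R * _) => t; lra.
apply: le_trans (fuglede_bound r0 esm (erefl e) lr) _.
have A0 := nrm_ge0 A.
have p1 : (1 + e) * nrm A * (1 + e) <= 4 * nrm A.
  have key (t : R) : 0 <= t -> t <= 1 -> (1 + t) * (1 + t) <= 4 by nra.
  by rewrite mulrAC ler_wpM2r // key.
have p2 : expR s * nrm A * e * expR s <= 1.
  apply: le_trans eK; rewrite /K mulrDr mulr1 -[leLHS]addr0 lerD //.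
  by rewrite le_eqVlt; apply/orP; left; apply/eqP; ring.
exact: lerD.
Qed.

End Fuglede.

(** * Uniform approximation on compact subsets of the plane *)

Section Bernstein.

(** The Bernstein polynomials of [g], i.e. the expectation of [g] at a binomial
    variable, through the recursion given by the last Bernoulli trial. *)
Fixpoint bern (K : comNzRingType) (t : K) n (g : nat -> K) : K :=
  if n is n'.+1 then (1 - t) * bern t n' g + t * bern t n' (fun k => g k.+1)
  else g 0.

Lemma bern_affine (K : comNzRingType) (t a b : K) n g :
  bern t n (fun k => a * g k + b) = a * bern t n g + b.
Proof. by elim: n g => [//|n IH] g /=; rewrite !IH; ring. Qed.

Lemma bern_cst (K : comNzRingType) (t b : K) n : bern t n (fun=> b) = b.
Proof. by elim: n => [//|n /= ->]; ring. Qed.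

Lemma bernD (K : comNzRingType) (t : K) n g h :
  bern t n (fun k => g k + h k) = bern t n g + bern t n h.
Proof. by elim: n g h => [//|n IH] g h /=; rewrite !IH; ring. Qed.

Lemma bern_variance (K : comNzRingType) (t a : K) n :
  bern t n (fun k => (k%:R - a) ^+ 2) = n%:R * t * (1 - t) + (n%:R * t - a) ^+ 2.
Proof.
elim: n a => [|n IH] a /=; first by ring.
rewrite IH (_ : (fun k => (k.+1%:R - a) ^+ 2) = fun k => (k%:R - (a - 1)) ^+ 2).
  by rewrite IH -[n.+1%:R]natr1; ring.
by apply/funext => k; rewrite -[k.+1%:R]natr1; ring.
Qed.

Variable R : realType.
Implicit Types (t x y : R).

Lemma ler_bern t n (g h : nat -> R) : 0 <= t <= 1 -> (forall k, g k <= h k) ->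
  bern t n g <= bern t n h.
Proof.
move=> /andP[t0 t1]; elim: n g h => [|n IH] g h gh /=; first exact: gh.
by apply: lerD; apply: ler_wpM2l; rewrite ?subr_ge0 // IH.
Qed.

Lemma rnorm_bern t n (g : nat -> R[i]) : 0 <= t <= 1 ->
  rnorm (bern t%:C%C n g) <= bern t n (fun k => rnorm (g k)).
Proof.
move=> /andP[t0 t1]; elim: n g => [//|n IH] g /=.
apply: le_trans (ler_rnormD _ _) _; rewrite !rnormM.
have -> : rnorm (1 - t%:C%C : R[i]) = 1 - t.
  by rewrite -(rmorph1 (real_complex R)) -rmorphB /= rnorm_real ger0_norm // subr_ge0.
rewrite rnorm_real ger0_norm //.
by apply: lerD; apply: ler_wpM2l; rewrite ?subr_ge0.
Qed.

(** Positivity of the Bernstein operators reduces the error to that of the quadratic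
    bound, which is a variance. *)
Lemma bern2_error x y (v : R[i]) n (F : nat -> nat -> R[i]) (e c : R) :
  0 <= x <= 1 -> 0 <= y <= 1 -> 0 <= c ->
  (forall k l, rnorm (F k l - v) <=
     e + c * ((k%:R - n%:R * x) ^+ 2 + (l%:R - n%:R * y) ^+ 2)) ->
  rnorm (bern x%:C%C n (fun k => bern y%:C%C n (F k)) - v) <= e + c * n%:R.
Proof.
move=> x01 y01 c0 Fv.
have -> : bern x%:C%C n (fun k => bern y%:C%C n (F k)) - v =
    bern x%:C%C n (fun k => bern y%:C%C n (fun l => F k l - v)).
  under [in RHS]eq_fun do rewrite (bernD _ _ _ (fun=> - v)) bern_cst.
  by rewrite (bernD _ _ _ (fun=> - v)) bern_cst.
apply: le_trans (rnorm_bern _ _ x01) _.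
apply: le_trans (ler_bern _ x01 (fun k => rnorm_bern _ _ y01)) _.
apply: le_trans (ler_bern _ x01 (fun k => ler_bern _ y01 (Fv k))) _.
have -> : (fun k => bern y n (fun l =>
      e + c * ((k%:R - n%:R * x) ^+ 2 + (l%:R - n%:R * y) ^+ 2))) =
    (fun k => c * (k%:R - n%:R * x) ^+ 2 + (e + c * (n%:R * y * (1 - y)))).
  apply/funext => k.
  rewrite (_ : (fun l => e + _) = fun l => c * (l%:R - n%:R * y) ^+ 2 +
     (e + c * (k%:R - n%:R * x) ^+ 2)); last by apply/funext => l; ring.
  by rewrite bern_affine bern_variance; ring.
rewrite bern_affine bern_variance subrr expr0n addr0.
rewrite [leLHS](_ : _ = e + c * (n%:R * (x * (1 - x) + y * (1 - y)))); last by ring.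
rewrite lerD2l ler_wpM2l // ler_piMr //.
by have := sqr_ge0 (2 * x - 1); have := sqr_ge0 (2 * y - 1); rewrite !expr2; lra.
Qed.

End Bernstein.

Section Weierstrass.
Variable R : realType.
Implicit Types (f g : R[i] -> R[i]) (q : {poly {poly R[i]}}).

(** The functions of the form of the approximants in [is_cfc]. *)
Definition zpoly g := exists q, forall z, bieval q z z^* = g z.

Lemma zpoly_cst a : zpoly (fun=> a).
Proof. by exists a%:P%:P => z; rewrite /bieval !hornerC. Qed.

Lemma zpoly_id : zpoly id.
Proof. by exists 'X%:P => z; rewrite /bieval hornerC hornerX. Qed.

Lemma zpoly_conj : zpoly (fun z => z^*).
Proof. by exists 'X => z; rewrite /bieval hornerX hornerC. Qed.

Lemma zpolyD f g : zpoly f -> zpoly g -> zpoly (fun z => f z + g z).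
Proof.
by move=> [p pf] [q qg]; exists (p + q) => z; rewrite -pf -qg /bieval !hornerD.
Qed.

Lemma zpolyM f g : zpoly f -> zpoly g -> zpoly (fun z => f z * g z).
Proof.
by move=> [p pf] [q qg]; exists (p * q) => z; rewrite -pf -qg /bieval !hornerM.
Qed.

Lemma zpoly_bern f n (G : nat -> R[i] -> R[i]) : zpoly f ->
  (forall k, zpoly (G k)) -> zpoly (fun z => bern (f z) n (fun k => G k z)).
Proof.
move=> pf; elim: n G => [|n IH] G pG /=; first exact: pG.
apply: zpolyD; apply: zpolyM => //; last exact: (IH (fun k => G k.+1)).
  have := zpolyD (zpoly_cst 1) (zpolyM (zpoly_cst (-1)) pf).
  by under eq_fun do rewrite mulN1r.
exact: IH.
Qed.

Lemma zpoly_Re : zpoly (fun z => (complex.Re z)%:C%C).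
Proof.
have := zpolyM (zpolyD zpoly_id zpoly_conj) (zpoly_cst (2^-1)).
by under eq_fun do rewrite -ReJ_add.
Qed.

Lemma zpoly_Im : zpoly (fun z => (complex.Im z)%:C%C).
Proof.
have := zpolyM (zpolyM (zpolyD zpoly_conj (zpolyM (zpoly_cst (-1)) zpoly_id))
   (zpoly_cst (2^-1))) (zpoly_cst 'i%C).
by under eq_fun do rewrite mulN1r -ImJ_sub.
Qed.

(** Weierstrass approximation, by Bernstein polynomials on a square that contains
    [K]. Since [f] matters on [K] only, each node of the grid is given the value of
    [f] at a nearby point of [K], if there is one. *)
Theorem weierstrass (K : set R[i]) f : compact K -> {within K, continuous f} ->
  forall e : R, 0 < e -> exists q, forall z, K z -> rnorm (bieval q z z^* - f z) <= e.
Proof.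
move=> cK cf e e0.
have [M0 M0P] := compact_bounded_fun cK cf; pose M := `|M0|.
have M_ge0 : 0 <= M by exact: normr_ge0.
have MP z : K z -> rnorm (f z) <= M by move=> /M0P/le_trans; apply; exact: ler_norm.
have [c0 c0P] := compact_bounded_fun cK (@continuous_subspaceT _ _ K id (fun x => cvg_id)).
pose c := `|c0| + 1; have c_gt0 : 0 < c by rewrite ltr_wpDl.
have cP z : K z -> rnorm z <= c.
  by move=> /c0P/le_trans; apply; apply: le_trans (ler_norm _) _; rewrite lerDl.
have e2 : 0 < e / 2 by rewrite divr_gt0.
have [r r0 rP] := compact_unif_cont cK cf e2.
pose d := r / 2; have d0 : 0 < d by rewrite divr_gt0.
(* [2 M / d^2] times the square of the distance bounds the error at nodes further
   than [d]; [2 c] is the side of the square. *)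
pose C := 2 * M / d ^+ 2 * (2 * c) ^+ 2.
have C0 : 0 <= C by rewrite mulr_ge0 ?sqr_ge0 // divr_ge0 ?sqr_ge0 // mulr_ge0.
pose n := (Num.truncn (C / (e / 2))).+1.
have n0 : 0 < n%:R :> R by rewrite ltr0n.
have Cn : C / n%:R <= e / 2.
  by rewrite ler_pdivrMr // mulrC -ler_pdivrMr // ltW // truncnS_gt.
pose node k l : R[i] := ((c * (2 * k%:R / n%:R - 1)) +i* (c * (2 * l%:R / n%:R - 1)))%C.
pose near k l := [set w | K w /\ rnorm (w - node k l) < d].
pose F k l : R[i] := if pselect (exists w, near k l w) is left ew
  then f (projT1 (cid ew)) else 0.
pose coord (t : R) : R := (2 * c)^-1 * t + 2^-1.
have [q qE] : zpoly (fun z => bern ((coord (complex.Re z))%:C%C) n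
    (fun k => bern ((coord (complex.Im z))%:C%C) n (F k))).
  apply: (@zpoly_bern (fun z => (coord (complex.Re z))%:C%C) n
    (fun k z => bern ((coord (complex.Im z))%:C%C) n (F k))).
    have := zpolyD (zpolyM (zpoly_cst (2 * c)^-1%:C%C) zpoly_Re) (zpoly_cst (2^-1)%:C%C).
    by under eq_fun do rewrite -rmorphM -rmorphD.
  move=> k; apply: (@zpoly_bern (fun z => (coord (complex.Im z))%:C%C) n
    (fun l _ => F k l)); last by move=> l; exact: zpoly_cst.
  have := zpolyD (zpolyM (zpoly_cst (2 * c)^-1%:C%C) zpoly_Im) (zpoly_cst (2^-1)%:C%C).
  by under eq_fun do rewrite -rmorphM -rmorphD.
exists q => z Kz; rewrite qE.
have coord01 t : `|t| <= c -> 0 <= coord t <= 1.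
  rewrite ler_norml => /andP[tc1 tc2].
  have -> : coord t = (t + c) / (2 * c) by rewrite /coord; field; rewrite gt_eqF.
  rewrite divr_ge0 ?ler_pdivrMr ?mulr_gt0 ?mul1r //; try lra.
have zRe := coord01 _ (le_trans (ler_rnorm_Re z) (cP z Kz)).
have zIm := coord01 _ (le_trans (ler_rnorm_Im z) (cP z Kz)).
rewrite [e]splitr; apply: le_trans (_ : e / 2 + C / n%:R ^+ 2 * n%:R <= _); last first.
  by rewrite lerD2l expr2 invfM mulrA divfK ?gt_eqF.
apply: bern2_error => //; first by rewrite divr_ge0 // sqr_ge0.
move=> k l.
have distE : rnorm (z - node k l) ^+ 2 = (2 * c) ^+ 2 / n%:R ^+ 2 *
    ((k%:R - n%:R * coord (complex.Re z)) ^+ 2 + (l%:R - n%:R * coord (complex.Im z)) ^+ 2).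
  rewrite rnormCE sqr_sqrtr ?addr_ge0 ?sqr_ge0 // /coord.
  rewrite /node; case: (z) => a b /=.
  by move: n%:R n0 => N N0; field; rewrite !gt_eqF.
have -> : C / n%:R ^+ 2 * ((k%:R - n%:R * coord (complex.Re z)) ^+ 2 +
    (l%:R - n%:R * coord (complex.Im z)) ^+ 2) =
    2 * M / d ^+ 2 * rnorm (z - node k l) ^+ 2 by rewrite distE /C; ring.
have M2 : 0 <= 2 * M by rewrite mulr_ge0.
have FM : rnorm (F k l) <= M.
  rewrite /F; case: pselect => [ew|_]; last by rewrite rnorm0.
  by case: (cid ew) => w [Kw _] /=; exact: MP.
have [zd|dz] := ltP (rnorm (z - node k l)) d.
  apply: le_trans (_ : e / 2 <= _); last first.
    by rewrite lerDl mulr_ge0 ?sqr_ge0 // divr_ge0 ?sqr_ge0.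
  rewrite /F; case: pselect => [ew|]; last by case; exists z.
  case: (cid ew) => w [Kw wd] /=; apply/ltW/rP => //.
  apply: le_lt_trans (ler_rdistD (node k l) _ _) _.
  by rewrite [r]splitr [X in _ + X]rdistC ltrD.
apply: le_trans (ler_rnormB _ _) _; apply: le_trans (lerD FM (MP _ Kz)) _.
apply: le_trans (_ : 2 * M <= _); first by lra.
rewrite ler_wpDl ?(ltW e2) // -mulrA ler_peMr // mulrC ler_pdivlMr ?exprn_gt0 //.
by rewrite mul1r ler_sqr ?nnegrE ?rnorm_ge0 ?(ltW d0).
Qed.

End Weierstrass.

(** * Continuous functional calculus *)

Section FunctionalCalculus.
Variables (R : realType) (H : completeNormedModType R[i]).
Variable ip : {dot H for @Num.conj R[i]}.
Hypothesis ip_norm : forall x : H, `|x| ^+ 2 = ip x x.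
Local Notation bop := (bop H).
Local Notation star := (star ip_norm).
Local Notation starpoly := (starpoly ip_norm).
Implicit Types (B F G : bop) (f g : R[i] -> R[i]) (q : {poly {poly R[i]}}).
Variable N : bop.
Hypothesis NN : GRing.comm N (star N).

(** [opbieval], as a bounded operator. *)
Definition opb q : bop :=
  \sum_(l < size q) \sum_(k < size q`_l) q`_l`_k *: (N ^+ k * star N ^+ l).

Lemma opbE q : opb q = opbieval q N (adjoint ip N) :> (H -> H).
Proof.
apply/funext => x; rewrite /opb bop_sumE; apply: eq_bigr => l _.
by rewrite bop_sumE; apply: eq_bigr => k _; rewrite bopZE bopME !bopXE.
Qed.

Lemma bievalE q z v :
  bieval q z v = \sum_(l < size q) \sum_(k < size q`_l) q`_l`_k * (z ^+ k * v ^+ l).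
Proof.
rewrite /bieval [q.[_]]horner_coef horner_sum; apply: eq_bigr => l _.
rewrite hornerM -rmorphXn /= hornerC horner_coef mulr_suml.
by apply: eq_bigr => k _; rewrite mulrA.
Qed.

Lemma starpoly_bieval q : starpoly N (fun z => bieval q z z^*) (opb q).
Proof.
under eq_fun do rewrite bievalE.
apply: (starpoly_sum _ (f := fun (l : 'I_(size q)) z =>
  \sum_(k < size q`_l) q`_l`_k * (z ^+ k * (z^*) ^+ l))) => l.
apply: (starpoly_sum _ (f := fun (k : 'I_(size q`_l)) z =>
  q`_l`_k * (z ^+ k * (z^*) ^+ l))) => k.
apply: (starpolyZ _ (f := fun z => z ^+ k * (z^*) ^+ l)).
apply: (starpolyM (f := fun z => z ^+ k) (g := fun z => (z^*) ^+ l)).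
  exact: starpolyX (starpoly_id _ _).
exact: starpolyX (starpoly_conj _ _).
Qed.

(** The norm of a polynomial in [N] and its adjoint is controlled by the function. *)
Lemma starpoly_unique f F G : starpoly N f F -> starpoly N f G -> F = G.
Proof.
move=> pF pG; apply/eqP; rewrite -subr_eq0; apply/eqP/nrm_eq0.
apply: (starpoly_nrm_le NN _ (starpolyB pF pG)) => // z _.
by rewrite subrr rnorm0.
Qed.

Lemma starpoly_zpoly f F : starpoly N f F ->
  exists q, (forall z, bieval q z z^* = f z) /\ opb q = F.
Proof.
move=> pF; have [q qf] : zpoly f.
  elim: pF => [a|||f1 g1 F1 G1 _ pf _ pg|f1 g1 F1 G1 _ pf _ pg].
  - exact: zpoly_cst.
  - exact: zpoly_id.
  - exact: zpoly_conj.
  - exact: zpolyD.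
  - exact: zpolyM.
exists q; split=> //; apply: starpoly_unique pF.
by have := starpoly_bieval q; under eq_fun do rewrite qf.
Qed.

Lemma starpoly_bounded f F : starpoly N f F ->
  exists2 c : R, 0 <= c & forall z, spectrum N z -> rnorm (f z) <= c.
Proof.
elim=> [a|||f1 g1 F1 G1 _ [c c0 fc] _ [d d0 gd]|f1 g1 F1 G1 _ [c c0 fc] _ [d d0 gd]].
- by exists (rnorm a); rewrite ?rnorm_ge0.
- by exists (nrm N); [exact: nrm_ge0|exact: spectrum_le].
- by exists (nrm N) => [|z]; [exact: nrm_ge0|rewrite rnorm_conj; exact: spectrum_le].
- exists (c + d) => [|z Nz]; first exact: addr_ge0.
  by apply: le_trans (ler_rnormD _ _) (lerD _ _); [exact: fc|exact: gd].
- exists (c * d) => [|z Nz]; first exact: mulr_ge0.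
  by rewrite rnormM; apply: ler_pM; rewrite ?rnorm_ge0 ?fc ?gd.
Qed.

(** [cfcr f F]: the operator [F] is the value at [N] of [f]. It amounts to [is_cfc],
    but approximation by one polynomial at a time is easier to combine than sequences
    of polynomials with coefficients. *)
Definition cfcr f F := forall e : R, 0 < e -> exists g G,
  [/\ starpoly N g G, forall z, spectrum N z -> rnorm (g z - f z) <= e
    & nrm (G - F) <= e].

Lemma cfcr_starpoly f F : starpoly N f F -> cfcr f F.
Proof.
move=> pF e e0; exists f, F; rewrite subrr nrm0 (ltW e0).
by split=> // z _; rewrite subrr rnorm0 ltW.
Qed.

Lemma cfcr_eq f g F : (forall z, spectrum N z -> f z = g z) -> cfcr f F -> cfcr g F.
Proof.
move=> fg fF e /fF[h [G [pG hf GF]]]; exists h, G; split=> // z Nz.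
by rewrite -fg ?hf.
Qed.

Lemma cfcr_nrm_le f F (c : R) : 0 <= c -> cfcr f F ->
  (forall z, spectrum N z -> rnorm (f z) <= c) -> nrm F <= c.
Proof.
move=> c0 fF fc; apply/ler_addgt0Pr => e e0.
have e2 : 0 < e / 2 by rewrite divr_gt0.
have [g [G [pG gf GF]]] := fF _ e2.
have Gc : nrm G <= e / 2 + c.
  apply: (starpoly_nrm_le NN _ pG) => [|z Nz]; first by rewrite addr_ge0 // ltW.
  by rewrite -(subrK (f z) (g z)); apply: le_trans (ler_rnormD _ _) (lerD _ _);
    [exact: gf|exact: fc].
rewrite -(subKr G F); apply: le_trans (ler_nrmB _ _) _.
by have := lerD Gc GF; lra.
Qed.

Lemma cfcr_bounded f F : cfcr f F ->
  exists2 c : R, 0 <= c & forall z, spectrum N z -> rnorm (f z) <= c.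
Proof.
move=> /(_ 1 ltr01)[g [G [/starpoly_bounded[c c0 gc] gf _]]].
exists (c + 1) => [|z Nz]; first by rewrite addr_ge0.
rewrite -(subKr (g z) (f z)); apply: le_trans (ler_rnormB _ _) (lerD _ _).
  exact: gc.
exact: gf.
Qed.

Lemma cfcrD f g F G : cfcr f F -> cfcr g G -> cfcr (fun z => f z + g z) (F + G).
Proof.
move=> fF gG e e0; have e2 : 0 < e / 2 by rewrite divr_gt0.
have [f' [F' [pF ff FF]]] := fF _ e2; have [g' [G' [pG gg GG]]] := gG _ e2.
exists (fun z => f' z + g' z), (F' + G'); split; first exact: starpolyD.
  move=> z Nz; rewrite opprD addrACA [e]splitr.
  by apply: le_trans (ler_rnormD _ _) (lerD _ _); [exact: ff|exact: gg].
by rewrite opprD addrACA [e]splitr; apply: le_trans (ler_nrmD _ _) (lerD _ _).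
Qed.

(** Multiplication is continuous on bounded sets, both for functions on the spectrum
    and for operators. *)
Lemma cfcrM f g F G : cfcr f F -> cfcr g G -> cfcr (fun z => f z * g z) (F * G).
Proof.
move=> fF gG e e0.
have [c c0 fc] := cfcr_bounded fF; have [d d0 gd] := cfcr_bounded gG.
pose M := c + d + nrm F + nrm G + 1.
have F0 := nrm_ge0 F; have G0 := nrm_ge0 G.
have M0 : 0 < M by rewrite /M; lra.
pose h := Num.min 1 (e / (2 * M)).
have h0 : 0 < h by rewrite lt_min ltr01 divr_gt0 ?mulr_gt0.
have h1 : h <= 1 by rewrite ge_min lexx.
have hM : h * (2 * M) <= e by rewrite -ler_pdivlMr ?mulr_gt0 // ge_min lexx orbT.
have key (x1 x2 : R) : 0 <= x1 -> 0 <= x2 -> x1 <= M -> x2 <= M -> h * x2 + x1 * h <= e.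
  by move=> *; apply: le_trans hM; move: h h0 {h1} => h h0; nra.
have [f' [F' [pF ff FF]]] := fF _ h0; have [g' [G' [pG gg GG]]] := gG _ h0.
exists (fun z => f' z * g' z), (F' * G'); split; first exact: starpolyM.
  move=> z Nz; have -> : f' z * g' z - f z * g z = (f' z - f z) * g' z + f z * (g' z - g z).
    by ring.
  have g'd : rnorm (g' z) <= 1 + d.
    rewrite -(subrK (g z) (g' z)); apply: le_trans (ler_rnormD _ _) (lerD _ _).
      exact: le_trans (gg _ Nz) h1.
    exact: gd.
  apply: le_trans (ler_rnormD _ _) _; rewrite !rnormM.
  apply: le_trans (lerD _ _) (key c (1 + d) c0 _ _ _); try by rewrite /M; lra.
    by apply: ler_pM; rewrite ?rnorm_ge0 ?ff.
  by apply: ler_pM; rewrite ?rnorm_ge0 ?fc ?gg.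
have -> : F' * G' - F * G = (F' - F) * G' + F * (G' - G).
  by rewrite mulrBl mulrBr addrA subrK.
have G'd : nrm G' <= 1 + nrm G.
  rewrite -(subrK G G'); apply: le_trans (ler_nrmD _ _) (lerD _ _) => //.
  exact: le_trans GG h1.
apply: le_trans (ler_nrmD _ _) _.
apply: le_trans (lerD (ler_nrmMM FF G'd) (ler_nrmMM (lexx _) GG)) _.
by apply: key => //; rewrite /M; lra.
Qed.

Lemma cfcrZ a f F : cfcr f F -> cfcr (fun z => a * f z) (a *: F).
Proof.
move=> fF; have := cfcrM (cfcr_starpoly (starpoly_cst _ N a)) fF.
by rewrite -scale_bopAl mul1r.
Qed.

Lemma cfcrB f g F G : cfcr f F -> cfcr g G -> cfcr (fun z => f z - g z) (F - G).
Proof.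
move=> fF gG; have := cfcrD fF (cfcrZ (-1) gG).
by rewrite scaleN1r; under eq_fun do rewrite mulN1r.
Qed.

Lemma cfcr_sum (I : Type) (r : seq I) (P : pred I) (f : I -> R[i] -> R[i])
    (F : I -> bop) : (forall i, cfcr (f i) (F i)) ->
  cfcr (fun z => \sum_(i <- r | P i) f i z) (\sum_(i <- r | P i) F i).
Proof.
move=> fF; elim: r => [|i r IH].
  have := cfcr_starpoly (starpoly_cst ip_norm N 0); rewrite scale0r big_nil.
  by under [in X in _ -> X]eq_fun do rewrite big_nil.
rewrite big_cons; under eq_fun do rewrite big_cons.
by case: (P i) => //; exact: cfcrD.
Qed.

Lemma cfcr_unique f F G : cfcr f F -> cfcr f G -> F = G.
Proof.
move=> fF fG; apply/eqP; rewrite -subr_eq0; apply/eqP/nrm_eq0.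
by apply: (cfcr_nrm_le _ (cfcrB fF fG)) => // z _; rewrite subrr rnorm0.
Qed.

(** By Fuglede's theorem, commuting with [N] is enough. *)
Lemma cfcr_comm B f F : GRing.comm B N -> cfcr f F -> GRing.comm B F.
Proof.
move=> BN fF; apply/eqP; rewrite -subr_eq0; apply/eqP/nrm_small => e e0.
have c0 : 0 < 2 * nrm B + 1 by rewrite ltr_wpDl // mulr_ge0 ?nrm_ge0.
have [g [G [pG _ GF]]] := fF _ (divr_gt0 e0 c0).
have BG : GRing.comm B G by exact: starpoly_comm BN (fuglede NN BN) pG.
have -> : B * F - F * B = (G - F) * B - B * (G - F).
  by rewrite mulrBl mulrBr BG opprB [RHS]addrC subrKA.
apply: le_trans (ler_nrmB _ _) _.
apply: le_trans (lerD (ler_nrmMM GF (lexx _)) (ler_nrmMM (lexx _) GF)) _.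
have key (b t : R) : 0 < t -> t * b + b * t <= t * (2 * b + 1) by lra.
by apply: le_trans (key _ _ (divr_gt0 e0 c0)) _; rewrite divfK ?gt_eqF.
Qed.

(** Uniform convergence of polynomials on the spectrum makes the corresponding
    operators a Cauchy sequence. *)
Lemma cfcr_exists f : {within spectrum N, continuous f} -> exists F, cfcr f F.
Proof.
move=> cf; have cN := @compact_spectrum _ _ N.
have /choice[q qP] n : exists q, forall z, spectrum N z ->
    rnorm (bieval q z z^* - f z) <= n.+1%:R^-1.
  by apply: (weierstrass cN cf); rewrite invr_gt0.
have [e e0|F FP] := @nrm_complete _ _ (fun n => opb (q n)).
  have e2 : 0 < e / 2 by rewrite divr_gt0.
  have [m mP] := invSn_lt e2; exists m => i j /mP/ltW ie /mP/ltW je.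
  apply: (starpoly_nrm_le NN (ltW e0)
    (starpolyB (starpoly_bieval (q i)) (starpoly_bieval (q j)))) => z Nz.
  rewrite [e]splitr; apply: le_trans (ler_rdistD (f z) _ _) (lerD _ _).
    exact: le_trans (qP _ _ Nz) ie.
  by rewrite rdistC; exact: le_trans (qP _ _ Nz) je.
exists F => e e0; have [m mP] := invSn_lt e0; have [k kP] := FP _ e0.
exists (fun z => bieval (q (maxn m k)) z z^*), (opb (q (maxn m k))); split.
- exact: starpoly_bieval.
- by move=> z Nz; apply: le_trans (qP _ _ Nz) (ltW (mP _ _)); rewrite leq_maxl.
- by rewrite kP ?leq_maxr.
Qed.

Lemma uniform_rnormP (M : set R[i]) (u : nat -> R[i] -> R[i]) f :
  {uniform M, u n @[n --> \oo] --> f} <->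
  forall e : R, 0 < e -> \forall n \near \oo, forall z, M z -> rnorm (u n z - f z) < e.
Proof.
split=> [uf e e0|uf P /uniform_nbhs[E [entE EP]]].
  have := uf [set h | forall z, M z -> rnorm (h z - f z) < e]; apply.
  apply/uniform_nbhs; exists [set xy | ball xy.1 e%:C%C xy.2]; split.
    by rewrite -entourage_from_ballE; exists e%:C%C => //=; rewrite ltcR.
  move=> h hP z /hP; rewrite -ball_normE /ball_ /= distrC rnormE ltcR //.
move: entE; rewrite -entourage_from_ballE => -[e /= e0 eE].
have [eE' e0'] := posC_Re e0.
apply: filterS (uf _ e0') => n un; apply: EP => z Mz; apply: eE => /=.
by rewrite -ball_normE /ball_ /= distrC rnormE eE' ltcR un.
Qed.

Lemma cfcr_is_cfc f F : cfcr f F -> is_cfc ip N f F.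
Proof.
move=> fF; split; first exact: bopP.
have /choice[q qP] n : exists q,
    (forall z, spectrum N z -> rnorm (bieval q z z^* - f z) <= n.+1%:R^-1) /\
    nrm (opb q - F) <= n.+1%:R^-1.
  have [|g [G [/starpoly_zpoly[q [qg <-]] gf GF]]] := fF n.+1%:R^-1.
    by rewrite invr_gt0.
  by exists q; split=> // z Nz; rewrite qg gf.
exists q; split.
  apply/uniform_rnormP => e /invSn_lt/nearooP; apply: filterS => n ne z Nz.
  exact: le_lt_trans ((qP n).1 z Nz) ne.
apply/cvgrPdist_lt => e /invSn_lt/nearooP; apply: filterS => n ne.
rewrite sub0r normrN -opbE.
have -> : opnorm ((opb (q n) : H -> H) - F) = nrm (opb (q n) - F) by [].
by rewrite ger0_norm ?nrm_ge0 // (le_lt_trans (qP n).2).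
Qed.

Lemma is_cfc_cfcr f (F : H -> H) : is_cfc ip N f F -> exists2 G : bop, F = G & cfcr f G.
Proof.
move=> [BF [q [/uniform_rnormP qf qF]]]; exists (Bop BF) => // e e0.
have [m mP] := (nearooP _).1 (qf _ e0).
have /cvgrPdist_lt/(_ e e0)/nearooP[k kP] := qF.
exists (fun z => bieval (q (maxn m k)) z z^*), (opb (q (maxn m k))); split.
- exact: starpoly_bieval.
- by move=> z Nz; apply/ltW/mP; rewrite ?leq_maxl.
- have := kP _ (leq_maxr m k); rewrite sub0r normrN -opbE => /ltW.
  by apply: le_trans; exact: ler_norm.
Qed.

Lemma cfcE f F : cfcr f F -> cfc ip N f = F.
Proof.
move=> fF; rewrite /cfc; case: xgetP => [G _ /is_cfc_cfcr[G' -> fG]|/(_ F)].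
  by rewrite (cfcr_unique fF fG).
by case; exact: cfcr_is_cfc.
Qed.

End FunctionalCalculus.

(** * Lagrange polynomials and the polyproduct *)

Section LagrangePolynomials.
Variables (R : realType) (d : nat) (lam : 'I_d -> R[i]).
Hypothesis lam_inj : injective lam.
Local Notation p := (pLambda lam).
Local Notation p' j := ((pLambda lam)^`().[lam j]).
Local Notation delta := (delta lam).

Definition copoly j : {poly R[i]} := \prod_(k < d | k != j) ('X - (lam k)%:P).

Lemma pLambdaE j : p = ('X - (lam j)%:P) * copoly j.
Proof. by rewrite /pLambda (bigD1 j). Qed.

Lemma horner_copoly j : (copoly j).[lam j] = p' j.
Proof.
by rewrite (pLambdaE j) derivM derivXsubC mul1r !hornerE subrr mul0r addr0.
Qed.

Lemma deriv_pLambda_neq0 j : p' j != 0.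
Proof.
rewrite -horner_copoly /copoly horner_prod; apply/prodf_neq0 => k kj.
by rewrite hornerXsubC subr_eq0; apply: contra_neq kj => /lam_inj.
Qed.

Lemma deltaE j : copoly j = p' j *: delta j.
Proof.
rewrite -horner_copoly /delta /copoly horner_prod scaler_prod scalerA -big_split /=.
rewrite [X in X *: _]big1 ?scale1r // => k kj.
rewrite hornerXsubC divff // subr_eq0; apply: contra_neq kj => /lam_inj->//.
Qed.

Lemma pLambda_delta j : p = p' j *: (('X - (lam j)%:P) * delta j).
Proof. by rewrite {1}(pLambdaE j) deltaE scalerAr. Qed.

Lemma size_pLambda : size p = d.+1.
Proof. by rewrite /pLambda -big_enum size_prod_XsubC size_enum_ord. Qed.

Lemma horner_delta j k : (delta j).[lam k] = (j == k)%:R.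
Proof.
apply: (mulfI (deriv_pLambda_neq0 j)); rewrite -hornerZ -deltaE.
have [<-|jk] := eqVneq j k; first by rewrite horner_copoly mulr1.
rewrite mulr0 /copoly horner_prod (bigD1 k) 1?eq_sym //=.
by rewrite hornerXsubC subrr mul0r.
Qed.

Lemma size_delta j : (size (delta j) <= d)%N.
Proof.
have d0 : (0 < d)%N by exact: leq_ltn_trans (leq0n j) (ltn_ord j).
rewrite -(size_scale _ (deriv_pLambda_neq0 j)) -deltaE.
have X0 : 'X - (lam j)%:P != 0 by rewrite polyXsubC_eq0.
have P0 : copoly j != 0.
  by apply: contra_eq_neq (size_pLambda) => P0; rewrite (pLambdaE j) P0 mulr0 size_poly0.
have := size_pLambda; rewrite (pLambdaE j) size_mul // size_XsubC /=.
by move=> /eqP; rewrite eqSS => /eqP->.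
Qed.

(** Both sides have degree less than [d] and take the value [1] at the [d] points
    [lam k]. *)
Lemma sum_delta : (0 < d)%N -> \sum_(j < d) delta j = 1.
Proof.
move=> d0; apply/eqP; rewrite -subr_eq0; apply/negPn/negP => D0.
have := @max_poly_roots _ _ [seq lam j | j : 'I_d] D0.
rewrite size_map size_enum_ord (map_inj_uniq lam_inj) enum_uniq => /(_ _ isT).
have -> : all (root (\sum_(j < d) delta j - 1)) [seq lam j | j : 'I_d].
  apply/allP => _ /mapP[k _ ->]; rewrite rootE hornerD hornerN hornerC horner_sum.
  rewrite (bigD1 k) //= horner_delta eqxx big1 ?addr0 ?subrr // => j jk.
  by rewrite horner_delta (negPf jk).
move=> /(_ isT); rewrite ltnNge => /negP; apply.
apply: leq_trans (size_polyD _ _) _; rewrite geq_max size_polyN size_poly1 d0 andbT.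
apply: leq_trans (size_sum _ _ _) _; apply/bigmax_leqP => j _; exact: size_delta.
Qed.

(** The coefficients of the correction terms of the polyproduct. *)
Definition cpoly j k : R[i] := (p' k * (lam j - lam k))^-1.

(** Up to scalars, [delta j] is [p / (X - lam j)]; this is the partial fraction
    expansion of [1 / ((X - lam j) (X - lam k))], multiplied by [p ^ 2]. *)
Lemma delta_mul j k : j != k ->
  delta j * delta k = p * (cpoly j k *: delta j + cpoly k j *: delta k).
Proof.
move=> jk; pose Xj := 'X - (lam j)%:P; pose Xk := 'X - (lam k)%:P.
have X0 : Xj * Xk != 0 by rewrite mulf_neq0 ?polyXsubC_eq0.
have pj := deriv_pLambda_neq0 j; have pk := deriv_pLambda_neq0 k.
have l0 : lam j - lam k != 0.
  by rewrite subr_eq0; apply: contra_neq jk => /lam_inj.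
have dj : Xj * delta j = (p' j)^-1 *: p.
  by rewrite {2}(pLambda_delta j) scalerA mulVf // scale1r.
have dk : Xk * delta k = (p' k)^-1 *: p.
  by rewrite {2}(pLambda_delta k) scalerA mulVf // scale1r.
apply: (mulfI X0).
have -> : Xj * Xk * (delta j * delta k) = (Xj * delta j) * (Xk * delta k) by ring.
have -> : Xj * Xk * (p * (cpoly j k *: delta j + cpoly k j *: delta k)) =
    p * (cpoly j k *: (Xk * (Xj * delta j)) + cpoly k j *: (Xj * (Xk * delta k))).
  by rewrite -!mul_polyC; ring.
rewrite dj dk -!mul_polyC /cpoly.
have -> : (p' k * (lam j - lam k))^-1 = (p' k)^-1 * (lam j - lam k)^-1 by rewrite invfM.
have -> : (p' j * (lam k - lam j))^-1 = - ((p' j)^-1 * (lam j - lam k)^-1).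
  by rewrite -opprB mulrN invrN invfM.
rewrite polyCN !polyCM /Xj /Xk.
have ll : (lam j - lam k)^-1%:P * ((lam j)%:P - (lam k)%:P) = 1 :> {poly R[i]}.
  by rewrite -polyCB -polyCM mulVf.
move: (p' j)^-1%:P (p' k)^-1%:P (lam j - lam k)^-1%:P (lam j)%:P (lam k)%:P ll.
move=> a b c x y cxy; rewrite -[LHS]mul1r -cxy; ring.
Qed.

Lemma polyprod_polyone f : polyprod lam f (polyone d) = f.
Proof.
apply/funext => w; apply/colP => i; rewrite !mxE big1 ?mulr0 ?subr0 ?mulr1 // => j _.
by rewrite !mxE subrr mulr0 mul0r.
Qed.

End LagrangePolynomials.

Section ChiAlgebra.
Variables (R : realType) (H : completeNormedModType R[i]).
Variables (d : nat) (lam : 'I_d -> R[i]).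
Hypotheses (d_gt0 : (0 < d)%N) (lam_inj : injective lam).
Local Notation bop := (bop H).
Local Notation c := (cpoly lam).

(** In the product of the two sums, the terms with [i != j] are rewritten with the
    hypothesis on [D i * D j], which [delta_mul] provides for Lagrange polynomials;
    exchanging [i] and [j] in half of the terms so obtained gives the correction terms
    of the polyproduct. *)
Lemma chi_algebraM (N : bop) (D F G : 'I_d -> bop) :
  \sum_i D i = 1 ->
  (forall i j, i != j -> D i * D j = N * (c i j *: D i + c j i *: D j)) ->
  (forall i, GRing.comm (D i) N) -> (forall i j, GRing.comm (D i) (F j)) ->
  \sum_i D i * (F i * G i - N * \sum_(j | j != i)
     c i j *: ((F i - F j) * (G i - G j))) =
  (\sum_i D i * F i) * (\sum_j D j * G j).
Proof.
move=> D1 DD DN DF.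
have -> : (\sum_i D i * F i) * (\sum_j D j * G j) =
    \sum_i \sum_j D i * D j * (F i * G j).
  rewrite mulr_suml; apply: eq_bigr => i _; rewrite mulr_sumr; apply: eq_bigr => j _.
  by rewrite -!mulrA [F i * (_ * _)]mulrA -DF !mulrA.
have diag : \sum_i D i * (F i * G i) = \sum_i \sum_j D i * D j * (F i * G i).
  apply: eq_bigr => i _; rewrite -mulr_suml -mulr_sumr D1 mulr1 //.
under eq_bigr do rewrite mulrBr.
rewrite sumrB diag; apply/eqP; rewrite subr_eq addrC -subr_eq; apply/eqP.
rewrite -sumrB; under eq_bigr do rewrite -sumrB.
have offdiag i : \sum_j (D i * D j * (F i * G i) - D i * D j * (F i * G j)) =
    \sum_(j | j != i) (N * (c i j *: (D i * (F i * (G i - G j)))) +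
                       N * (c j i *: (D j * (F i * (G i - G j))))).
  rewrite (bigD1 i) //= subrr add0r; apply: eq_bigr => j ji.
  rewrite -!mulrBr DD 1?eq_sym // -mulrDr -mulrA mulrDl -!scale_bopAl //.
under eq_bigr do rewrite offdiag big_split.
rewrite big_split /=.
have -> : \sum_i \sum_(j | j != i) N * (c j i *: (D j * (F i * (G i - G j)))) =
    \sum_i \sum_(j | j != i) N * (c i j *: (D i * (F j * (G j - G i)))).
  rewrite (exchange_big_dep predT) //=; apply: eq_bigr => i _.
  by apply: eq_bigl => j; rewrite eq_sym.
rewrite -big_split /=; apply: eq_bigr => i _; rewrite -big_split /=.
rewrite [D i * (N * _)]mulrA DN -mulrA !mulr_sumr; apply: eq_bigr => j ji.
rewrite -mulrDr -scalerDr -mulrDr -scale_bopAr.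
by rewrite [(F i - F j) * _]mulrBl -(opprB (G i)) mulrN.
Qed.

End ChiAlgebra.

(** * The homomorphism *)

Section CLambdaNorm.
Variables (R : realType) (d : nat) (lam : 'I_d -> R[i]) (M : set R[i]).
Hypotheses (d_gt0 : (0 < d)%N) (compactM : compact M) (M_neq0 : M !=set0).
Implicit Types (f g : R[i] -> 'cV[R[i]]_d) (B : R).

Definition bounded_on f B := forall w j, M w -> rnorm (f w j 0) <= B.

Lemma CLambda_coord f j : CLambda M f -> {within M, continuous (fun w => f w j 0)}.
Proof.
move=> cf; apply: (@within_continuous_comp _ _ _ M f (fun v : 'cV[R[i]]_d => v j 0)) => //.
by move=> v _; exact: coord_continuous.
Qed.

Lemma CLambda_bounded f : CLambda M f -> exists B, bounded_on f B.
Proof.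
move=> cf.
have /choice[B BP] j : exists B, forall w, M w -> rnorm (f w j 0) <= B.
  exact: (compact_bounded_fun compactM (@CLambda_coord f j cf)).
exists (\sum_j `|B j|) => w j Mw; apply: le_trans (BP j w Mw) _.
rewrite (bigD1 j) //=; apply: le_trans (ler_norm _) _.
by rewrite lerDl sumr_ge0.
Qed.

Lemma maxnorm_le f B : bounded_on f B -> maxnorm M f <= B.
Proof.
move=> fB; apply: ge_sup.
  have [w Mw] := M_neq0; exists (rnorm (f w (Ordinal d_gt0) 0)).
  by exists w => //; exists (Ordinal d_gt0).
by move=> _ [w Mw [j _ <-]]; exact: fB.
Qed.

Lemma maxnorm_ub f B w j : bounded_on f B -> M w -> rnorm (f w j 0) <= maxnorm M f.
Proof.
move=> fB Mw; apply: ub_le_sup; last by exists w => //; exists j.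
by exists B => _ [v Mv [k _ <-]]; exact: fB.
Qed.

(** A bound that is uniform in [g] makes the supremum [CLnorm lam M f] a genuine one. *)
Lemma polyprod_bounded f B : bounded_on f B ->
  exists K, forall g, bounded_on g 1 -> bounded_on (polyprod lam f g) K.
Proof.
move=> fB; have [W WP] := compact_bounded_fun compactM
  (@continuous_subspaceT _ _ M id (fun x => cvg_id)).
pose e i j : R := rnorm ((pLambda lam)^`().[lam j] * (lam i - lam j))^-1.
pose k i : R := `|B| * 1 + `|W| * \sum_(j < d | j != i) (2 * `|B| * 2 * e i j).
have fB' w i : M w -> rnorm (f w i 0) <= `|B|.
  by move=> Mw; apply: le_trans (ler_norm _); exact: fB.
have e0 i j : 0 <= e i j by exact: rnorm_ge0.
have k0 i : 0 <= k i.
  by rewrite addr_ge0 ?mulr_ge0 // sumr_ge0 // => j _; rewrite !mulr_ge0.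
exists (\sum_i k i) => g gB w i Mw.
apply: (@le_trans _ _ (k i)); last by rewrite (bigD1 i) //= lerDl sumr_ge0.
rewrite mxE; apply: le_trans (ler_rnormB _ _) (lerD _ _).
  by rewrite rnormM; apply: ler_pM; rewrite ?rnorm_ge0 ?fB' ?gB.
rewrite rnormM; apply: ler_pM; rewrite ?rnorm_ge0 //.
  by apply: le_trans (ler_norm _); exact: WP.
apply: le_trans (ler_rnorm_sum _ _ _) (ler_sum _ _) => j _.
rewrite !rnormM; apply: ler_wpM2r; first exact: e0.
apply: ler_pM; rewrite ?rnorm_ge0 //; apply: le_trans (ler_rnormB _ _) _.
  by rewrite mulr_natl mulr2n lerD ?fB'.
by rewrite [leRHS](_ : 2 = 1 + 1 :> R) ?lerD ?gB.
Qed.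

(** The unit [polyone d] has max norm at most [1], and its polyproduct with [f] is [f]. *)
Lemma maxnorm_le_CLnorm f B : bounded_on f B -> maxnorm M f <= CLnorm lam M f.
Proof.
move=> fB; have [K KP] := polyprod_bounded fB; apply: ub_le_sup.
  exists K => _ [g [cg /= g1] <-]; have [G GP] := CLambda_bounded cg.
  by apply/maxnorm_le/KP => w j Mw; apply: le_trans g1; exact: maxnorm_ub GP Mw.
exists (polyone d); last by rewrite polyprod_polyone.
split; first by apply: continuous_subspaceT; exact: cst_continuous.
by apply: maxnorm_le => w j _; rewrite mxE rnorm1.
Qed.

End CLambdaNorm.

Section Chi.
Variables (R : realType) (H : completeNormedModType R[i]).
Variable ip : {dot H for @Num.conj R[i]}.
Hypothesis ip_norm : forall x : H, `|x| ^+ 2 = ip x x.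
Local Notation bop := (bop H).
Variables (A : bop) (d : nat) (lam : 'I_d -> R[i]).
Hypotheses (d_gt0 : (0 < d)%N) (lam_inj : injective lam).
Let N : bop := hev (pLambda lam) A.
Hypothesis NN : GRing.comm N (star ip_norm N).
Implicit Types (f g : R[i] -> 'cV[R[i]]_d) (F G : 'I_d -> bop).

Definition cfcv f F := forall j, cfcr ip_norm N (fun w => f w j 0) (F j).

Definition chiop F : bop := \sum_j hev (delta lam j) A * F j.

Lemma cfcv_exists f : CLambda (spectrum N) f -> exists F, cfcv f F.
Proof.
move=> cf; have /choice[F FP] j : exists T : bop, cfcr ip_norm N (fun w => f w j 0) T.
  by apply: cfcr_exists => //; exact: CLambda_coord.
by exists F.
Qed.

Lemma chiE f F : cfcv f F -> chi ip lam A f = chiop F :> (H -> H).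
Proof.
move=> fF; apply/funext => x; rewrite /chi /chiop fct_sumE bop_sumE.
apply: eq_bigr => j _; rewrite bopME /= -!hevE.
by rewrite (cfcE NN (fF j)).
Qed.

Lemma cfcv_polyone : cfcv (polyone d) (fun=> 1).
Proof.
move=> j; have := cfcr_starpoly (starpoly_cst ip_norm N 1); rewrite scale1r.
by apply: cfcr_eq => z _; rewrite mxE.
Qed.

Lemma chiop1 : chiop (fun=> 1) = 1.
Proof.
rewrite /chiop; under eq_bigr do rewrite mulr1.
by rewrite -hev_sum sum_delta // hevC scale1r.
Qed.

Lemma cfcv_linear a f g F G : cfcv f F -> cfcv g G ->
  cfcv (a *: f + g) (fun j => a *: F j + G j).
Proof.
move=> fF gG j; apply: (cfcr_eq _ (cfcrD (cfcrZ a (fF j)) (gG j))) => z _.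
by rewrite !mxE.
Qed.

Lemma chiop_linear a F G : chiop (fun j => a *: F j + G j) = a *: chiop F + chiop G.
Proof.
rewrite /chiop scaler_sumr -big_split; apply: eq_bigr => j _.
by rewrite mulrDr -scale_bopAr.
Qed.

Lemma cfcv_polyprod f g F G : cfcv f F -> cfcv g G -> cfcv (polyprod lam f g)
  (fun i => F i * G i - N * \sum_(j | j != i)
     cpoly lam i j *: ((F i - F j) * (G i - G j))).
Proof.
move=> fF gG i; have cN : cfcr ip_norm N id N by exact: cfcr_starpoly (starpoly_id _ _).
have fg j : cfcr ip_norm N (fun w => cpoly lam i j *
    ((f w i 0 - f w j 0) * (g w i 0 - g w j 0)))
    (cpoly lam i j *: ((F i - F j) * (G i - G j))).
  by apply/cfcrZ => //; apply: cfcrM => //; apply: cfcrB.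
apply: (cfcr_eq _ (cfcrB (cfcrM (fF i) (gG i)) (cfcrM cN
  (cfcr_sum (index_enum 'I_d) (fun j => j != i) fg)))) => w _.
by rewrite mxE; congr (_ - _ * _); apply: eq_bigr => j _; rewrite mulrC.
Qed.

(** All the operators involved commute: [A] commutes with the values at [N] of
    continuous functions by Fuglede's theorem, since it commutes with [N]. *)
Lemma chiopM f g F G : cfcv f F -> cfcv g G ->
  chiop (fun i => F i * G i - N * \sum_(j | j != i)
     cpoly lam i j *: ((F i - F j) * (G i - G j))) = chiop F * chiop G.
Proof.
move=> fF gG; apply: chi_algebraM.
- by have := chiop1; rewrite /chiop; under eq_bigr do rewrite mulr1.
- by move=> i j ij; rewrite -hevM delta_mul // hevM hevD !hevZ.
- by move=> i; exact: hev_comm.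
- move=> i j; apply: commr_sym; apply: comm_hev; apply: commr_sym.
  by apply: cfcr_comm (fF j) => //; apply: comm_hev; exact: commr_refl.
Qed.

(** By the triangle inequality, since the norm of [F j] is at most the maximum of the
    modulus of the [j]-th component of [f] on the spectrum. *)
Lemma chiop_nrm_le f F : (exists x : H, x != 0) -> cfcv f F ->
  nrm (chiop F) <= (\sum_j nrm (hev (delta lam j) A)) * CLnorm lam (spectrum N) f.
Proof.
move=> H0 fF; have N0 : spectrum N !=set0 by exact: normal_spectrum_neq0 NN H0.
have cN := @compact_spectrum _ _ N.
have /choice[B BP] j : exists B, forall z, spectrum N z -> rnorm (f z j 0) <= B.
  by have [B _ ?] := cfcr_bounded (fF j); exists B.
have fB : bounded_on (spectrum N) f (\sum_j `|B j|).
  move=> w j Nw; apply: le_trans (BP j w Nw) _.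
  by rewrite (bigD1 j) //=; apply: le_trans (ler_norm _) _; rewrite lerDl sumr_ge0.
have fC := maxnorm_le_CLnorm lam d_gt0 cN N0 fB.
rewrite /chiop mulr_suml; apply: le_trans (ler_nrm_sum _ _ _) (ler_sum _ _) => j _.
apply: ler_nrmMM => //; apply: le_trans fC.
have fm w : spectrum N w -> rnorm (f w j 0) <= maxnorm (spectrum N) f.
  by move=> Nw; exact: maxnorm_ub fB Nw.
apply: (cfcr_nrm_le NN _ (fF j) fm).
by have [w /fm] := N0; apply: le_trans; exact: rnorm_ge0.
Qed.

End Chi.

Theorem theorem3p12 (R : realType) (H : completeNormedModType R[i])
    (ip : {dot H for @Num.conj R[i]})
    (ip_norm : forall x : H, `|x| ^+ 2 = ip x x)
    (H_neq0 : exists x : H, x != 0)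
    (A : H -> H) (bounded_A : BH A)
    (d : nat) (d_gt0 : (0 < d)%N)
    (lam : 'I_d -> R[i]) (lam_inj : injective lam)
    (normal_N : normal_op ip (opeval (pLambda lam) A)) :
  let M := [set (pLambda lam).[z] | z in spectrum A] in
  let chiA := chi ip lam A in
  [/\ (forall f, CLambda M f -> BH (chiA f)),
      (chiA (polyone d) = idfun /\
       forall (a : R[i]) f g, CLambda M f -> CLambda M g ->
         chiA (a *: f + g) = a *: chiA f + chiA g),
      (forall f g, CLambda M f -> CLambda M g ->
         chiA (polyprod lam f g) = chiA f \o chiA g),
      (forall f, CLambda M f ->
         opnorm (chiA f)
           <= (\sum_(j < d) opnorm (opeval (delta lam j) A)) * CLnorm lam M f)
    & (forall f, CLambda M f -> forall e : R, 0 < e ->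
         exists2 r : R, 0 < r &
           forall g, CLambda M g -> CLnorm lam M (g - f) < r ->
             opnorm (chiA g - chiA f) < e)].
Proof.
move=> M chiA; pose B : bop H := Bop bounded_A; pose N := hev (pLambda lam) B.
have NN : GRing.comm N (star ip_norm N).
  apply: bop_ext => x; have [_] := normal_N; rewrite -(hevE _ B) => /(congr1 (@^~ x)).
  by [].
have ME : M = spectrum N.
  by rewrite /N spectral_mapping // size_pLambda.
have CF f : CLambda M f -> exists F, cfcv ip_norm B lam f F.
  by rewrite ME; exact: cfcv_exists.
pose c := \sum_j nrm (hev (delta lam j) B).
have cE : c = \sum_(j < d) opnorm (opeval (delta lam j) A).
  by apply: eq_bigr => j _; rewrite /nrm hevE.
split.
- by move=> f /CF[F /(chiE NN) fF]; rewrite /chiA fF; exact: bopP.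
- split.
    by rewrite /chiA (chiE NN (cfcv_polyone ip_norm B lam)) chiop1.
  move=> a f g /CF[F fF] /CF[G gG]; rewrite /chiA (chiE NN (cfcv_linear a fF gG)).
  by rewrite chiop_linear (chiE NN fF) (chiE NN gG).
- move=> f g /CF[F fF] /CF[G gG]; rewrite /chiA (chiE NN (cfcv_polyprod fF gG)).
  by rewrite (chiopM d_gt0 lam_inj NN fF gG) (chiE NN fF) (chiE NN gG).
- move=> f /CF[F fF]; rewrite -cE ME /chiA (chiE NN fF).
  exact: chiop_nrm_le H_neq0 fF.
move=> f /CF[F fF] e e0.
have c1 : 0 < c + 1 by rewrite ltr_wpDl // sumr_ge0 // => j _; exact: nrm_ge0.
exists (e / (c + 1)) => [|g /CF[G gG] gf]; first exact: divr_gt0.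
have gfE : g - f = (-1) *: f + g by rewrite scaleN1r addrC.
have gfF := cfcv_linear (-1) fF gG.
have -> : opnorm (chiA g - chiA f) = nrm (chiop B lam (fun j => (-1) *: F j + G j)).
  by rewrite chiop_linear scaleN1r addrC /chiA (chiE NN fF) (chiE NN gG).
rewrite gfE ME in gf.
apply: le_lt_trans (chiop_nrm_le d_gt0 NN H_neq0 gfF) _.
have c0 : 0 <= c by apply: sumr_ge0 => j _; exact: nrm_ge0.
apply: (@le_lt_trans _ _ (c * (e / (c + 1)))); first exact: ler_wpM2l (ltW gf).
by rewrite mulrCA gtr_pMr // ltr_pdivrMr // mul1r ltrDl.
Qed.
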